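(* (Twisted Schrödinger–Lichnerowicz formula.) Let $M$ be an $n$-dimensional Riemannian $Spin^{c,r}$ manifold with twisted spinor bundle $S$, and fix connections $\theta$ and $iA$ on the auxiliary bundles $P_{SO(r)}$ and $P_{U(1)}$. Let $\phi\in\Gamma(S)$. Then $$\partial\!\!\!/^{\theta,A}(\partial\!\!\!/^{\theta,A}(\phi))=\Delta^{\theta,A}(\phi)+\frac{\mathrm{R}}{4}\phi+\frac12\tilde\Theta\cdot\phi+\frac i2\,dA\cdot\phi,$$ where $\mathrm{R}$ is the scalar curvature of $M$.
   Context: $\Delta_n$ is the complex spinor module of $\mathbb{R}^n$ (Clifford relation $e_je_k+e_ke_j=-2\langle e_j,e_k\rangle$), $\kappa_n$ the spin representation; $\kappa_{r*}(f_kf_l)$ denotes Clifford multiplication by $f_kf_l$ on $\Delta_r$. $\Sigma_r=\Delta_r$ for $r$ odd and $\Sigma_r=\Delta_r^+$ (positive half-spinors) for $r$ even, $r\ge1$. $Spin^c(r)=(Spin(r)\times U(1))/\{\pm(1,1)\}$ and $Spin^{c,r}(n)=(Spin(n)\times Spin^c(r))/\{\pm(1,1)\}$, with two-fold covering $\lambda_{n,r,2}([g,[h,z]])=(\lambda_n(g),\lambda_r(h),z^2)$ onto $SO(n)\times SO(r)\times U(1)$ and representation $[g,[h,z]]\mapsto z\,\kappa_r(h)\otimes\kappa_n(g)$ on $\Sigma_r\otimes\Delta_n$ (for $r=1$: $Spin^{c,1}(n)=Spin^c(n)$ acting on $\Delta_n$). A $Spin^{c,r}$ manifold is an oriented Riemannian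 $n$-manifold $M$ with a principal $SO(r)$ bundle $P_{SO(r)}$, a principal $U(1)$ bundle $P_{U(1)}$, and a principal $Spin^{c,r}(n)$ bundle $P$ with a two-fold covering $P\to P_{SO(M)}\tilde\times P_{SO(r)}\tilde\times P_{U(1)}$ (fibered product) equivariant via $\lambda_{n,r,2}$. $S=P\times_{Spin^{c,r}(n)}(\Sigma_r\otimes\Delta_n)$, $F$ is the rank $r$ vector bundle associated to $P_{SO(r)}$. Vectors and forms on $M$ act on $S$ by Clifford multiplication on the $\Delta_n$ factor; $\kappa_{r*}(f_kf_l)$ acts on the $\Sigma_r$ factor. With local orthonormal frames $(e_i)$ of $TM$, $(f_k)$ of $F$, Levi-Civita forms $\omega_{ij}=\langle\nabla e_i,e_j\rangle$, forms $\theta_{kl}=\langle\nabla^\theta f_k,f_l\rangle$ and local form $iA$ of the connection on $P_{U(1)}$: $\nabla^{\theta,A}=d+\frac12\sum_{i<j}\omega_{ij}e_ie_j\cdot+\frac12\sum_{k<l}\theta_{kl}\,\kappa_{r*}(f_kf_l)\cdot+\frac i2A$. $\partial\!\!\!/^{\theta,A}\phi=\sum_i e_i\cdot\nabla^{\theta,A}_{e_i}\phi$; $\ \Delta^{\theta,A}\phi=-\sum_i\nabla^{\theta,A}_{e_i}\nabla^{\theta,A}_{e_i}\phi-\sum_i\mathrm{div}(e_i)\nabla^{\theta,A}_{e_i}\phi$. $\Theta_{kl}(X,Y)=\langle R^F(X,Y)f_k,f_l\rangle$ with $R^F$ the curvature of $(F,\nabla^\theta)$; $\tilde\Theta\cdot\phi=\sum_{k<l}\Theta_{kl}\cdot\kappa_{r*}(f_kf_l)\cdot\phi$,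 where a $2$-form $\alpha$ acts as $\sum_{i<j}\alpha(e_i,e_j)e_ie_j\cdot$; $dA$ is the (real) curvature $2$-form of the connection on $P_{U(1)}$. *)

(* Defs.v *)
From HB Require Import structures.
From mathcomp Require Import all_boot all_order all_algebra.
From mathcomp Require Import complex mxtens.
From mathcomp Require Import all_classical all_reals all_analysis.

Set Implicit Arguments.
Unset Strict Implicit.
Unset Printing Implicit Defensive.

Import Order.TTheory GRing.Theory Num.Theory.
Import numFieldNormedType.Exports.

Local Open Scope classical_set_scope.
Local Open Scope ring_scope.

(** * Oriented smooth manifolds *)

Fixpoint Ck (R : realType) (n k : nat) (W : set 'rV[R]_n)
    (h : 'rV[R]_n -> R^o) : Prop :=
  match k with
  | 0 => forall x, W x -> {for x, continuous h}
  | k'.+1 => (forall x, W x -> differentiable h x) /\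
             forall v, Ck k' W (fun x => 'D_v h x)
  end.

Definition Cinfty (R : realType) (n : nat) (W : set 'rV[R]_n)
    (h : 'rV[R]_n -> R^o) : Prop := forall k, Ck k W h.

Record chart (R : realType) (n : nat) (T : topologicalType) := Chart {
  cdom : set T;
  cfun : T -> 'rV[R]_n;
  cinv : 'rV[R]_n -> T;
  cdom_open : open cdom;
  cimg_open : open (cfun @` cdom);
  cfunK : forall p, cdom p -> cinv (cfun p) = p;
  cfun_cont : forall p, cdom p -> {for p, continuous cfun};
  cinv_cont : forall y, (cfun @` cdom) y -> {for y, continuous cinv} }.

(** The atlas is oriented: its transition maps are smooth with positive
    Jacobian determinant. Each point [p] carries a preferred chart
    [chart_at p] of the atlas, used only to identify the tangent space at [p]
    with ['rV[R]_n]. *)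
Record oriented_manifold (R : realType) (n : nat) := OrientedManifold {
  mpoint :> topologicalType;
  mpoint_hausdorff : hausdorff_space mpoint;
  mpoint_countable : @second_countable mpoint;
  atlas : set (chart R n mpoint);
  chart_at : mpoint -> chart R n mpoint;
  chart_at_atlas : forall p, atlas (chart_at p);
  chart_at_dom : forall p, cdom (chart_at p) p;
  transition_smooth : forall c d, atlas c -> atlas d -> forall k,
    Cinfty (cfun c @` (cdom c `&` cdom d))
      (fun y => cfun d (cinv c y) ord0 k);
  transition_oriented : forall c d p, atlas c -> atlas d ->
    cdom c p -> cdom d p ->
    0 < \det (\matrix_(i < n, k < n)
      ('D_(delta_mx ord0 i) (fun y => cfun d (cinv c y) ord0 k : R^o)
         (cfun c p) : R)) }.

Section Calculus.
Context (R : realType) (n : nat) (M : oriented_manifold R n).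

Definition smooth_on (U : set M) (f : M -> R) : Prop :=
  forall c, atlas c ->
    Cinfty (cfun c @` (U `&` cdom c)) (fun y => f (cinv c y)).

(** The derivative [v f] of [f] along the tangent vector [v] at [p]. *)
Definition dv (p : M) (v : 'rV[R]_n) (f : M -> R) : R :=
  'D_v (fun y => f (cinv (chart_at p) y) : R^o) (cfun (chart_at p) p).

Definition vector_field := M -> 'rV[R]_n.

Definition smooth_vector_field (U : set M) (X : vector_field) : Prop :=
  forall c, atlas c -> forall k,
    smooth_on (U `&` cdom c) (fun p => dv p (X p) (fun q => cfun c q ord0 k)).

Definition one_form := M -> 'rV[R]_n -> R.

Definition smooth_one_form (U : set M) (a : one_form) : Prop :=
  (forall p, U p -> forall t v w, a p (t *: v + w) = t * a p v + a p w) /\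
  (forall (V : set M) (X : vector_field), open V -> V `<=` U ->
     smooth_vector_field V X -> smooth_on V (fun p => a p (X p))).

(** Component [k] of [[X, Y]] at [p] is [X (Y x_k) - Y (X x_k)] for the
    coordinates [x_k] of the chart identifying the tangent space at [p]. *)
Definition lie (X Y : vector_field) : vector_field := fun p =>
  \row_(k < n) (let x := fun q : M => cfun (chart_at p) q ord0 k in
    dv p (X p) (fun q => dv q (Y q) x) - dv p (Y p) (fun q => dv q (X q) x)).

(** [(d a)(X, Y)] at [p]. *)
Definition ext_d (a : one_form) (X Y : vector_field) (p : M) : R :=
  dv p (X p) (fun q => a q (Y q)) - dv p (Y p) (fun q => a q (X q))
  - a p (lie X Y p).

Definition dvC (p : M) (v : 'rV[R]_n) (f : M -> R[i]) : R[i] :=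
  Complex (dv p v (fun q => complex.Re (f q)))
          (dv p v (fun q => complex.Im (f q))).

(** ** Riemannian metrics and the Levi-Civita connection *)

Record riemannian_metric := RiemannianMetric {
  metric :> M -> 'rV[R]_n -> 'rV[R]_n -> R;
  metric_linear : forall p t u v w,
    metric p (t *: u + v) w = t * metric p u w + metric p v w;
  metric_sym : forall p v w, metric p v w = metric p w v;
  metric_pos : forall p v, v != 0 -> 0 < metric p v v;
  metric_smooth : forall (U : set M) (X Y : vector_field), open U ->
    smooth_vector_field U X -> smooth_vector_field U Y ->
    smooth_on U (fun p => metric p (X p) (Y p)) }.

(** [nabla p v Y] is the covariant derivative at [p] of a vector field [Y],
    smooth near [p], along the tangent vector [v]. *)
Record levi_civita (g : riemannian_metric) := LeviCivita {
  nabla :> forall p : M, 'rV[R]_n -> vector_field -> 'rV[R]_n;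
  nabla_linear : forall (U : set M) Y, open U -> smooth_vector_field U Y ->
    forall p, U p -> forall t v w,
    nabla p (t *: v + w) Y = t *: nabla p v Y + nabla p w Y;
  nabla_add : forall (U : set M) Y Z, open U ->
    smooth_vector_field U Y -> smooth_vector_field U Z ->
    forall p, U p -> forall v,
    nabla p v (fun q => Y q + Z q) = nabla p v Y + nabla p v Z;
  nabla_leibniz : forall (U : set M) f Y, open U ->
    smooth_on U f -> smooth_vector_field U Y ->
    forall p, U p -> forall v,
    nabla p v (fun q => f q *: Y q) = dv p v f *: Y p + f p *: nabla p v Y;
  nabla_smooth : forall (U : set M) X Y, open U ->
    smooth_vector_field U X -> smooth_vector_field U Y ->
    smooth_vector_field U (fun p => nabla p (X p) Y);
  nabla_metric : forall (U : set M) Y Z, open U ->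
    smooth_vector_field U Y -> smooth_vector_field U Z ->
    forall p, U p -> forall v,
    dv p v (fun q => g q (Y q) (Z q))
      = g p (nabla p v Y) (Z p) + g p (Y p) (nabla p v Z);
  nabla_torsion_free : forall (U : set M) X Y, open U ->
    smooth_vector_field U X -> smooth_vector_field U Y ->
    forall p, U p -> nabla p (X p) Y - nabla p (Y p) X = lie X Y p }.

Definition riem (g : riemannian_metric) (lc : levi_civita g)
    (X Y Z : vector_field) : vector_field := fun p =>
  lc p (X p) (fun q => lc q (Y q) Z) - lc p (Y p) (fun q => lc q (X q) Z)
  - lc p (lie X Y p) Z.

(** Positively oriented orthonormal frames of the tangent space at [p]; the
    vectors of the frame are the rows of [E]. *)
Definition oriented_orthonormal (g : riemannian_metric) (p : M)
    (E : 'M[R]_n) : Prop :=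
  (forall i j, g p (row i E) (row j E) = (i == j)%:R) /\ 0 < \det E.

(** ** Principal bundles *)

(** A group presented as the quotient of the group [gmem] (with operations
    [gone], [gmul] on an ambient type) by its normal subgroup [gker]; a map
    into [gmem] is smooth when its composites with the real functions in
    [gcoord] are. *)
Record group_data := GroupData {
  gcarrier : Type;
  gmem : set gcarrier;
  gone : gcarrier;
  gmul : gcarrier -> gcarrier -> gcarrier;
  gker : set gcarrier;
  gcoord : set (gcarrier -> R) }.

Definition smooth_map (G : group_data) (U : set M) (h : M -> gcarrier G) : Prop :=
  (forall x, U x -> gmem (h x)) /\
  forall f, gcoord f -> smooth_on U (fun x => f (h x)).

(** On [U], [t = s h] with [h] locally a smooth map into [G]. *)
Definition smooth_change (G : group_data) (P : Type) (act : P -> gcarrier G -> P)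
    (U : set M) (s t : M -> P) : Prop :=
  forall x, U x -> exists (V : set M) (h : M -> gcarrier G),
    [/\ open V, V x, V `<=` U, smooth_map V h
      & forall y, V y -> t y = act (s y) (h y)].

(** Right [G]-torsors over the points of [M], the smooth structure being given
    by local sections [gsec a] over the sets of an open cover [gdom], with
    smooth transition functions. The quotient of [gmem G] by [gker G] acts
    simply transitively on the fibres. *)
Record principal_bundle (G : group_data) := PrincipalBundle {
  total :> Type;
  pr : total -> M;
  act : total -> gcarrier G -> total;
  pr_act : forall p h, gmem h -> pr (act p h) = pr p;
  act_one : forall p, act p (gone G) = p;
  act_mul : forall p h k, gmem h -> gmem k ->
    act p (gmul h k) = act (act p h) k;
  act_free : forall p h, gmem h -> (act p h = p <-> gker h);
  act_trans : forall p q, pr p = pr q -> exists2 h, gmem h & q = act p h;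
  gindex : Type;
  gdom : gindex -> set M;
  gsec : gindex -> M -> total;
  gdom_open : forall a, open (gdom a);
  gdom_cover : forall x, exists a, gdom a x;
  gsec_pr : forall a x, gdom a x -> pr (gsec a x) = x;
  gsec_smooth : forall a b,
    smooth_change act (gdom a `&` gdom b) (gsec a) (gsec b) }.

Definition smooth_section (G : group_data) (P : principal_bundle G)
    (U : set M) (s : M -> P) : Prop :=
  [/\ open U, forall x, U x -> pr (s x) = x
    & forall a : gindex P,
        smooth_change (@act _ P) (U `&` gdom a) (gsec a) s].

(** ** Connections on SO(r) and U(1) bundles *)

Definition SO_group (r : nat) : group_data :=
  @GroupData 'M[R]_r [set L | L^T *m L = 1%:M /\ \det L = 1] 1%:M
    (fun L L' => L *m L') [set 1%:M]
    [set f | exists k l, f = fun L : 'M[R]_r => L k l].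

Definition U1_group : group_data :=
  @GroupData R[i] [set z | `|z| = 1] 1 (fun z w => z * w) [set 1]
    [set f | f = @complex.Re R \/ f = @complex.Im R].

(** A principal connection given by its local forms: to a smooth section
    [f = (f_1, .., f_r)] correspond the forms
    [theta_kl = < nabla f_k, f_l >]; this is the transpose of the usual
    matrix of the connection ([nabla f = f a], [a' = h^-1 a h + h^-1 dh]),
    whence the form of the gauge transformation law. *)
Record SO_connection (r : nat) (Q : principal_bundle (SO_group r)) :=
  SOConnection {
  theta :> (M -> Q) -> M -> 'rV[R]_n -> 'M[R]_r;
  theta_skew : forall U f, smooth_section U f -> forall x v, U x ->
    (theta f x v)^T = - theta f x v;
  theta_smooth : forall U f, smooth_section U f -> forall k l,
    smooth_one_form U (fun x v => theta f x v k l);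
  theta_gauge : forall U (f f' : M -> Q) (h : M -> 'M[R]_r),
    smooth_section U f -> smooth_section U f' ->
    smooth_map (G := SO_group r) U h ->
    (forall x, U x -> f' x = act (f x) (h x)) ->
    forall x v, U x ->
    theta f' x v = (h x)^T *m theta f x v *m h x
      + (\matrix_(k, l) dv x v (fun y => h y k l))^T *m h x }.

(** The local form of the connection in the gauge [u] is [i A], with [A] real;
    under [u' = u h] it becomes [i A' = i A + h^-1 dh]. *)
Record U1_connection (Q : principal_bundle U1_group) := U1Connection {
  connA :> (M -> Q) -> M -> 'rV[R]_n -> R;
  connA_smooth : forall U u, smooth_section U u ->
    smooth_one_form U (connA u);
  connA_gauge : forall U (u u' : M -> Q) (h : M -> R[i]),
    smooth_section U u -> smooth_section U u' ->
    smooth_map (G := U1_group) U h ->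
    (forall x, U x -> u' x = act (u x) (h x)) ->
    forall x v, U x ->
    'i%C * (connA u' x v)%:C%C
      = 'i%C * (connA u x v)%:C%C + (h x)^-1 * dvC x v h }.

(** The covariant derivative on the vector bundle [F] associated to [Q], and
    its curvature: in the local frame [f], a section [sum_k a_k f_k] of [F] is
    the row of its coefficients. *)
Section VectorBundle.
Context (r : nat) (Q : principal_bundle (SO_group r)).
Context (th : SO_connection Q) (f : M -> Q).

Definition nablaF (p : M) (v : 'rV[R]_n) (a : M -> 'rV[R]_r) : 'rV[R]_r :=
  \row_l dv p v (fun q => a q ord0 l) + a p *m th f p v.

Definition curvF (X Y : vector_field) (a : M -> 'rV[R]_r) (p : M)
    : 'rV[R]_r :=
  nablaF p (X p) (fun q => nablaF q (Y q) a)
  - nablaF p (Y p) (fun q => nablaF q (X q) a)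
  - nablaF p (lie X Y p) a.

Definition Theta (k l : 'I_r) (X Y : vector_field) (p : M) : R :=
  curvF X Y (fun=> delta_mx ord0 k) p ord0 l.

End VectorBundle.

End Calculus.

(** * Spinors *)

Section Spinors.
Context (R : realType).
Local Notation C := R[i].

(** [Delta_n] is [C^(sdim n./2)], of dimension [2 ^ n./2]. *)
Fixpoint sdim (k : nat) : nat := if k is k'.+1 then (sdim k' * 2)%N else 1%N.

Definition mx2 (a b c d : C) : 'M[C]_2 :=
  \matrix_(i < 2, j < 2)
    if i == ord0 then (if j == ord0 then a else b)
    else (if j == ord0 then c else d).

Definition g1 := mx2 'i%C 0 0 (- 'i%C).
Definition g2 := mx2 0 'i%C 'i%C 0.
Definition gt := mx2 0 (- 'i%C) 'i%C 0.

(** The standard model: the [j]-th basis vector acts on [(C^2)^(tensor k)] as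
    [1 .. 1 g1 T .. T] or [1 .. 1 g2 T .. T] (tensor products, with [j./2]
    factors [T]), and for [n = 2 k + 1] the last one as [i T .. T]. *)
Fixpoint gamma_rec (k j : nat) : 'M[C]_(sdim k) :=
  match k with
  | 0 => 'i%C%:M
  | k'.+1 =>
    match j with
    | 0 => tensmx (1%:M : 'M[C]_(sdim k')) g1
    | 1 => tensmx (1%:M : 'M[C]_(sdim k')) g2
    | j'.+2 => tensmx (gamma_rec k' j') gt
    end
  end.

Definition gamma (n : nat) (j : 'I_n) : 'M[C]_(sdim n./2) :=
  gamma_rec n./2 j.

Definition gammav (n : nat) (v : 'rV[R]_n) : 'M[C]_(sdim n./2) :=
  \sum_j (v ord0 j)%:C%C *: gamma j.

Definition unit_vector (n : nat) (v : 'rV[R]_n) : Prop :=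
  \sum_j v ord0 j ^+ 2 = 1.

(** [Spin n], identified with its image under the (faithful) spin
    representation: products of an even number of unit vectors. *)
Definition Spin (n : nat) : set 'M[C]_(sdim n./2) :=
  [set g | exists s : seq ('rV[R]_n * 'rV[R]_n),
    (forall vw, vw \in s -> unit_vector vw.1 /\ unit_vector vw.2) /\
    g = \big[mulmx/1%:M]_(vw <- s) (gammav vw.1 *m gammav vw.2)].

(** [L = lambda_n g], the double covering of [SO(n)]:
    [g e_j g^-1 = sum_i L_ij e_i]. *)
Definition spin_cover (n : nat) (g : 'M[C]_(sdim n./2)) (L : 'M[R]_n)
    : Prop :=
  forall j, g *m gamma j *m invmx g = \sum_i (L i j)%:C%C *: gamma i.

Definition spin_triple (n r : nat) : Type :=
  ('M[C]_(sdim n./2) * 'M[C]_(sdim r./2) * C)%type.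

(** [Spin^{c,r}(n)] is the quotient of [Spin(n) x Spin(r) x U(1)] by the
    subgroup of the triples of signs of product [1]: it is generated by
    [(1, -1, -1)], giving [Spin^c(r)], and [(-1, -1, 1) ~ (-1, 1, -1)]. The
    class [[g, [h, z]]] is represented by [(g, h, z)]. *)
Definition Spincr_group (n r : nat) : group_data R :=
  @GroupData R (spin_triple n r)
    [set t | [/\ @Spin n t.1.1, @Spin r t.1.2 & `|t.2| = 1]]
    (1%:M, 1%:M, 1)
    (fun t u => (t.1.1 *m u.1.1, t.1.2 *m u.1.2, t.2 * u.2))
    [set t | exists a b : bool,
       t = (((-1) ^+ a)%:M, ((-1) ^+ b)%:M, (-1) ^+ (a + b)%N)]
    [set f | exists part : C -> R,
       (part = @complex.Re R \/ part = @complex.Im R) /\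
       [\/ exists i j, f = fun t : spin_triple n r => part (t.1.1 i j),
           exists i j, f = fun t : spin_triple n r => part (t.1.2 i j)
         | f = fun t : spin_triple n r => part t.2]].

(** [Delta_r (x) Delta_n] is a space of matrices, [x (x) y] being [x *m y^T]:
    operators on [Delta_r] act by left multiplication and operators on
    [Delta_n] by right multiplication by their transpose. *)
Definition twisted (n r : nat) := 'M[C]_(sdim r./2, sdim n./2).

(** [i^(r/2) f_1 .. f_r], whose [+1]-eigenspace for [r] even is
    [Delta_r^+]. *)
Definition volume (r : nat) : 'M[C]_(sdim r./2) :=
  'i%C ^+ r./2 *: \big[mulmx/1%:M]_(k < r) gamma k.

(** The subspace [Sigma_r (x) Delta_n]. *)
Definition in_Sigma (n r : nat) (psi : twisted n r) : Prop :=
  ~~ odd r -> volume r *m psi = psi.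

(** [z kappa_r(h) (x) kappa_n(g)]. *)
Definition spincr_rep (n r : nat) (t : spin_triple n r)
    (psi : twisted n r) : twisted n r :=
  t.2 *: (t.1.2 *m psi *m t.1.1^T).

(** Clifford multiplication by [e_i], and [kappa_{r*}(f_k f_l)]. *)
Definition cl (n r : nat) (i : 'I_n) (psi : twisted n r) : twisted n r :=
  psi *m (gamma i)^T.

Definition kappaF (n r : nat) (k l : 'I_r) (psi : twisted n r)
    : twisted n r :=
  gamma k *m gamma l *m psi.

End Spinors.

(** * Spin^{c,r} manifolds and their twisted Dirac operators *)

Section TwistedDirac.
Context (R : realType) (n r : nat) (M : oriented_manifold R n).
Context (g : riemannian_metric M).
Local Notation C := R[i].

(** The equivariant bundle map
    [P -> P_SO(M) x P_SO(r) x P_U(1)] (fibered product) is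
    [(tframe, toSO, toU)]. By equivariance it is a two-fold covering, as
    [lambda_{n,r,2}] is one. *)
Record spincr_structure := SpincrStructure {
  PSO : principal_bundle M (SO_group R r);
  PU : principal_bundle M (U1_group R);
  Pspin : principal_bundle M (Spincr_group R n r);
  tframe : Pspin -> 'M[R]_n;
  toSO : Pspin -> PSO;
  toU : Pspin -> PU;
  tframe_frame : forall p, oriented_orthonormal g (pr p) (tframe p);
  toSO_pr : forall p, pr (toSO p) = pr p;
  toU_pr : forall p, pr (toU p) = pr p;
  tframe_act : forall (p : Pspin) (t : spin_triple R n r) L,
    gmem (g := Spincr_group R n r) t -> spin_cover t.1.1 L ->
    tframe (act p t) = L^T *m tframe p;
  toSO_act : forall (p : Pspin) (t : spin_triple R n r) L,
    gmem (g := Spincr_group R n r) t -> spin_cover t.1.2 L ->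
    toSO (act p t) = act (toSO p) L;
  toU_act : forall (p : Pspin) (t : spin_triple R n r),
    gmem (g := Spincr_group R n r) t ->
    toU (act p t) = act (toU p) (t.2 ^+ 2);
  tframe_smooth : forall U (s : M -> Pspin), smooth_section U s ->
    forall i, smooth_vector_field U (fun x => row i (tframe (s x)));
  toSO_smooth : forall U (s : M -> Pspin), smooth_section U s ->
    smooth_section U (fun x => toSO (s x));
  toU_smooth : forall U (s : M -> Pspin), smooth_section U s ->
    smooth_section U (fun x => toU (s x)) }.

Context (lc : levi_civita g) (S : spincr_structure).
Context (th : SO_connection (PSO S)) (A : U1_connection (PU S)).
Local Notation P := (Pspin S).
Local Notation V := (twisted R n r).

(** Smooth sections of the associated bundle [S = P x (Sigma_r (x) Delta_n)],
    as equivariant maps on [P]: the section is [[p, phi p]]. *)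
Definition twisted_spinor (phi : P -> V) : Prop :=
  [/\ forall p, in_Sigma (phi p),
      forall (p : P) (t : spin_triple R n r), gmem (g := Spincr_group R n r) t ->
        spincr_rep t (phi (act p t)) = phi p
    & forall U (s : M -> P), smooth_section U s -> forall a b,
        smooth_on U (fun x => complex.Re (phi (s x) a b)) /\
        smooth_on U (fun x => complex.Im (phi (s x) a b))].

(** The differential operators are given by their local expressions: a field
    of spinors [Psi] has an expression [Psi s : M -> V] in each local section
    [s] of [P], which induces a local frame [e_i] of [TM] and local sections
    of [P_SO(r)] and [P_U(1)]. *)
Definition local_field := (M -> P) -> M -> V.

Definition expr (phi : P -> V) : local_field := fun s x => phi (s x).

Definition eframe (s : M -> P) (i : 'I_n) : vector_field M :=
  fun x => row i (tframe (s x)).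

Definition fSO (s : M -> P) : M -> PSO S := fun x => toSO (s x).
Definition fU (s : M -> P) : M -> PU S := fun x => toU (s x).

Definition omega (s : M -> P) (i j : 'I_n) : one_form M :=
  fun x v => g x (lc x v (eframe s i)) (eframe s j x).

Definition nablaS (Psi : local_field) (s : M -> P) (x : M) (v : 'rV[R]_n)
    : V :=
  \matrix_(a, b) dvC x v (fun y => Psi s y a b)
  + 2^-1 *: (\sum_(i < n) \sum_(j < n | (i < j)%N)
      (omega s i j x v)%:C%C *: cl i (cl j (Psi s x)))
  + 2^-1 *: (\sum_(k < r) \sum_(l < r | (k < l)%N)
      (th (fSO s) x v k l)%:C%C *: kappaF k l (Psi s x))
  + ('i%C / 2 * (A (fU s) x v)%:C%C) *: Psi s x.

(** [nabla_{e_i} Psi], as a field. *)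
Definition nablaE (i : 'I_n) (Psi : local_field) : local_field :=
  fun s x => nablaS Psi s x (eframe s i x).

Definition Dirac (Psi : local_field) : local_field := fun s x =>
  \sum_i cl i (nablaE i Psi s x).

Definition divergence (s : M -> P) (X : vector_field M) (x : M) : R :=
  \sum_j g x (lc x (eframe s j x) X) (eframe s j x).

Definition laplacian (Psi : local_field) : local_field := fun s x =>
  - (\sum_i nablaE i (nablaE i Psi) s x)
  - \sum_i (divergence s (eframe s i) x)%:C%C *: nablaE i Psi s x.

Definition scal (s : M -> P) (x : M) : R :=
  \sum_i \sum_j g x (riem lc (eframe s i) (eframe s j) (eframe s j) x) (eframe s i x).

(** Clifford action of the 2-form whose value on [(e_i, e_j)] is
    [alpha i j]. *)
Definition cl2 (alpha : 'I_n -> 'I_n -> R) (psi : V) : V :=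
  \sum_(i < n) \sum_(j < n | (i < j)%N) (alpha i j)%:C%C *: cl i (cl j psi).

Definition cl_Theta (Psi : local_field) : local_field := fun s x =>
  \sum_(k < r) \sum_(l < r | (k < l)%N)
    cl2 (fun i j => Theta th (fSO s) k l (eframe s i) (eframe s j) x)
      (kappaF k l (Psi s x)).

Definition cl_dA (Psi : local_field) : local_field := fun s x =>
  cl2 (fun i j => ext_d (A (fU s)) (eframe s i) (eframe s j) x) (Psi s x).

End TwistedDirac.

(* Main.v *)
Require Import Defs.
From mathcomp Require Import all_boot all_order all_algebra.
From mathcomp Require Import complex mxtens ring.
From mathcomp Require Import all_classical all_reals all_analysis.

Set Implicit Arguments.
Unset Strict Implicit.
Unset Printing Implicit Defensive.

Import Order.TTheory GRing.Theory Num.Theory.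
Import numFieldNormedType.Exports.

Local Open Scope classical_set_scope.
Local Open Scope ring_scope.

(** Everything is computed in the orthonormal frame [e_i] induced by the local
    section [s]. There the twisted connection is [d] plus a matrix-valued form
    acting on the right through [Delta_n] and one acting on the left through
    [Sigma_r], so spinors are just smooth matrix-valued functions on [U].

    Since Clifford multiplication is parallel ([nab_cl]), the square of the
    Dirac operator is [sum_ij e_i e_j H_ij], where [H_ij] is the second
    covariant derivative along [e_i] and [e_j]. The relation [e_i e_i = -1]
    turns the diagonal into the Laplacian, and the anticommutation of the
    [e_i] turns the rest into [sum_(i<j) e_i e_j (H_ij - H_ji)]
    ([cl_double_sum]). By torsion-freeness the antisymmetric part of [H] is the
    curvature of the twisted connection, with no first-order term left
    ([nab_commutator], [frame_torsion]).

    This curvature has three parts. The [U(1)] part is [(i/2) dA] and the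
    [SO(r)] part is the bivector of [Theta]; both give their term of the
    formula at once ([twist_contraction]). The spin part is the bivector of the
    Riemann tensor, because the bivector map is a morphism of Lie algebras
    ([bivector_bracket], [curv_cbivector]). Its Clifford contraction
    collapses to a quarter of the scalar curvature by the first Bianchi identity
    ([curvature_contraction], [Ricci_contraction]).

    On the analytic side this rests on the symmetry of second derivatives
    ([derive_sym]), which gives [[X, Y] f = X (Y f) - Y (X f)] ([dv_lie]), hence
    the Jacobi identity ([lie_jacobi]) and, with vanishing torsion, the Bianchi
    identity ([riem_bianchi]). *)

(** * Smooth functions on open sets of coordinate space *)

Section SmoothFunctions.
Context (R : realType) (n : nat).
Implicit Types (W : set 'rV[R]_n) (h : 'rV[R]_n -> R^o).

Lemma near_open_eq (T : topologicalType) (T' : Type) (W : set T) (h h' : T -> T') x :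
  open W -> W x -> (forall y, W y -> h y = h' y) -> \forall y \near x, h y = h' y.
Proof.
by move=> oW Wx e; apply: filterS (open_nbhs_nbhs (conj oW Wx)).
Qed.

Lemma near_differentiable (h h' : 'rV[R]_n -> R^o) x :
  (\forall y \near x, h y = h' y) -> differentiable h x -> differentiable h' x.
Proof.
move=> e dh; have [dc dE] := (diff_locallyP _ _).1 dh.
have dE' : h' \o shift x = cst (h' x) + 'd h x +o_ (0 : 'rV[R]_n) id.
  apply/eqaddoP => eps eps0; have dEe := (eqaddoP _ _ _ _).1 dE _ eps0.
  have e' := e; rewrite (near_shift 0) subr0 in e'.
  apply: filterS2 dEe e' => y /= dEy ey; rewrite !fctE /= in dEy *.
  by rewrite -ey -(nbhs_singleton e).
have du := diff_unique dc dE'.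
by apply/diff_locallyP; rewrite du.
Qed.

Lemma Ck_ext k W h h' : open W -> (forall x, W x -> h x = h' x) ->
  Ck k W h -> Ck k W h'.
Proof.
move=> oW; elim: k h h' => [|k IH] h h' e /=.
  move=> ch x Wx; have := ch x Wx; rewrite /prop_for /continuous_at (e x Wx).
  by apply: cvg_trans; apply: (near_eq_cvg (near_open_eq oW Wx e)).
case=> dh Dh; split=> [x Wx|v]; last first.
  apply: IH (Dh v) => x Wx; apply: near_eq_derive.
  exact: (near_open_eq oW Wx e).
by apply: near_differentiable (dh x Wx); exact: (near_open_eq oW Wx e).
Qed.

Lemma Ck_leq j k W h : (j <= k)%N -> Ck k W h -> Ck j W h.
Proof.
elim: k j h => [|k IH] [|j] h //= jk [dh Dh].
  by move=> x Wx; apply: differentiable_continuous; apply: dh.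
by split=> // v; apply: IH (Dh v).
Qed.

Lemma Ck_cst k W (a : R) : Ck k W (fun=> a : R^o).
Proof.
elim: k a => [|k IH] a /=; first by move=> x _; apply: cst_continuous.
split=> [x _|v]; first exact: differentiable_cst.
by under [X in Ck _ _ X]funext => x do rewrite derive_cst; apply: IH.
Qed.

Lemma Ck_add k W h h' : open W -> Ck k W h -> Ck k W h' ->
  Ck k W (fun x => h x + h' x).
Proof.
move=> oW; elim: k h h' => [|k IH] h h' /=.
  by move=> ch ch' x Wx; apply: continuousD; [apply: ch|apply: ch'].
case=> dh Dh [dh' Dh']; split=> [x Wx|v].
  by apply: differentiableD; [apply: dh|apply: dh'].
apply: Ck_ext (IH _ _ (Dh v) (Dh' v)) => // x Wx.
by rewrite deriveD //; apply: diff_derivable; [apply: dh|apply: dh'].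
Qed.

Lemma Ck_mul k W h h' : open W -> Ck k W h -> Ck k W h' ->
  Ck k W (fun x => h x * h' x).
Proof.
move=> oW; elim: k h h' => [|k IH] h h' /=.
  by move=> ch ch' x Wx; apply: continuousM; [apply: ch|apply: ch'].
case=> dh Dh [dh' Dh']; split=> [x Wx|v].
  by apply: differentiableM; [apply: dh|apply: dh'].
have Ch : Ck k W h by apply: Ck_leq (leqnSn k) _; split.
have Ch' : Ck k W h' by apply: Ck_leq (leqnSn k) _; split.
apply: Ck_ext (Ck_add oW (IH _ _ Ch (Dh' v)) (IH _ _ Ch' (Dh v))) => // x Wx.
by rewrite deriveM //; apply: diff_derivable; [apply: dh|apply: dh'].
Qed.

Lemma Ck_subset k W W' h : W' `<=` W -> Ck k W h -> Ck k W' h.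
Proof.
move=> sW; elim: k h => [|k IH] h /=; first by move=> ch x /sW; apply: ch.
by case=> dh Dh; split=> [x /sW|v]; [apply: dh|apply: IH].
Qed.

Lemma differentiable_row m (F : 'rV[R]_n -> 'rV[R]_m) x :
  (forall k, differentiable (fun y => F y ord0 k : R^o) x) ->
  differentiable F x.
Proof.
move=> dF.
have -> : F = \sum_(k < m) (fun y => F y ord0 k *: delta_mx ord0 k).
  by apply/funext => y; rewrite fct_sumE [LHS]row_sum_delta.
apply: differentiable_sum => k; apply: differentiableZl; exact: dF.
Qed.

(** The chain rule in coordinates, the form in which changes of charts enter. *)
Lemma derive_comp_row m (F : 'rV[R]_n -> 'rV[R]_m) (f : 'rV[R]_m -> R^o) x v :
  (forall k, differentiable (fun y => F y ord0 k : R^o) x) ->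
  differentiable f (F x) ->
  'D_v (fun y => f (F y)) x
    = \sum_k ('D_v (fun y => F y ord0 k : R^o) x : R)
             * 'D_(delta_mx ord0 k) f (F x).
Proof.
move=> dFk df; have dF := differentiable_row dFk.
rewrite [LHS]deriveE; last exact: (differentiable_comp dF df).
rewrite (diff_comp dF df) /= [X in 'd f _ X]row_sum_delta linear_sum /=.
apply: eq_bigr => k _; rewrite linearZ /= -(deriveE _ df); congr (_ * _).
rewrite -deriveE // derive_mx ?mxE //.
exact: diff_derivable.
Qed.

Lemma dist_triangle_half (a b c e : R) :
  `|a - c| < e / 2 -> `|b - c| < e / 2 -> `|a - b| <= e.
Proof.
move=> ac bc; rewrite [leRHS]splitr (le_trans (ler_distD c _ _))//.
by rewrite lerD// ltW// distrC.
Qed.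

Lemma mean_value_line (f : 'rV[R]_n -> R^o) (a u : 'rV[R]_n) (h : R) : 0 < h ->
  (forall t : R, 0 <= t <= h -> differentiable f (a + t *: u)) ->
  exists2 t, 0 <= t <= h & f (a + h *: u) - f a = h * 'D_u f (a + t *: u).
Proof.
move=> h0 df; pose l (t : R) : 'rV[R]_n := a + t *: u.
have lE t : (fun k : R => k^-1 *: (((f \o l) \o shift t) (k *: 1) - (f \o l) t))
    = (fun k => k^-1 *: ((f \o shift (l t)) (k *: u) - f (l t))).
  apply/funext => k /=; rewrite /l /shift /= [k *: 1]mulr1 scalerDl.
  by rewrite addrCA.
have dfl t : t \in `[0, h] -> is_derive t 1 ((f \o l) : R -> R) ('D_u f (l t)).
  rewrite in_itv /= => /df dft; apply: DeriveDef; last by rewrite /derive lE.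
  by rewrite /derivable lE; apply: diff_derivable.
have dfo t (t0h : t \in `]0, h[) := dfl t (subset_itv_oo_cc t0h).
have cf : {within `[0, h], continuous (f \o l : R -> R)}.
  by apply: derivable_within_continuous => t /dfl [].
have [t t0h E] := MVT_segment (ltW h0) dfo cf.
exists t; first by move: t0h; rewrite in_itv.
by move: E; rewrite subr0 /= /l scale0r addr0 mulrC.
Qed.

Lemma derive_shift_arg (f : 'rV[R]_n -> R^o) c u y :
  'D_u (fun z => f (z + c)) y = 'D_u f (y + c).
Proof.
by rewrite /derive; under eq_fun do rewrite /= -addrA.
Qed.

(** Applying the mean value theorem first along [u], then along [v], to the
    mixed second difference of [f]. The difference is symmetric in [u] and [v],
    the resulting second derivative is not visibly so: comparing the two gives
    Schwarz's theorem. *)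
Lemma second_difference (f : 'rV[R]_n -> R^o) (x u v : 'rV[R]_n) (h d : R) :
  0 < h -> h * (`|u| + `|v|) < d ->
  (forall y, ball x d y -> differentiable f y) ->
  (forall y, ball x d y -> differentiable ('D_u f : _ -> R^o) y) ->
  exists2 p, ball x d p &
    f (x + h *: u + h *: v) - f (x + h *: u) - (f (x + h *: v) - f x)
      = h ^+ 2 * 'D_v ('D_u f) p.
Proof.
move=> h0 hd df dDf.
have inB s t : 0 <= s <= h -> 0 <= t <= h -> ball x d (x + s *: u + t *: v).
  move=> /andP[s0 sh] /andP[t0 th]; rewrite -ball_normE /= opprD addrA opprD addrA.
  rewrite subrr add0r -opprD normrN.
  apply: le_lt_trans hd; rewrite (le_trans (ler_normD _ _))//.
  by rewrite !normrZ (ger0_norm s0) (ger0_norm t0) mulrDr lerD// ler_wpM2r.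
have h0h : 0 <= h <= h by rewrite lexx ltW.
have z0h : 0 <= (0 : R) <= h by rewrite lexx ltW.
have inB0 s : 0 <= s <= h -> ball x d (x + s *: u).
  by move=> sh; have := inB s 0 sh z0h; rewrite scale0r addr0.
have dsh y : ball x d (y + h *: v) -> differentiable (fun z => f (z + h *: v) : R^o) y.
  move=> By; apply: (@differentiable_comp _ _ _ _ (fun z => z + h *: v) f) => //.
  exact: df.
pose phi (y : 'rV[R]_n) : R^o := f (y + h *: v) - f y.
have dphi s : 0 <= s <= h -> differentiable phi (x + s *: u).
  move=> sh; apply: differentiableB; first by apply: dsh; apply: inB.
  by apply: df; apply: inB0.
have [s sh Es] := mean_value_line h0 dphi.
have [t th Et] := @mean_value_line ('D_u f) (x + s *: u) v h h0
  (fun t th => dDf _ (inB s t sh th)).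
exists (x + s *: u + t *: v); first exact: inB.
rewrite -[LHS]/(phi (x + h *: u) - phi x) Es.
rewrite /phi deriveB; first last.
- by apply: diff_derivable; apply: df; apply: inB0.
- by apply: diff_derivable; apply: dsh; apply: inB.
by rewrite derive_shift_arg Et expr2 mulrA.
Qed.

(** Schwarz's theorem: both mixed derivatives are limits of the same second
    difference quotients. *)
Lemma derive_sym W (f : 'rV[R]_n -> R^o) x u v : open W -> W x -> Ck 2 W f ->
  'D_u ('D_v f) x = 'D_v ('D_u f) x.
Proof.
move=> oW Wx [df Df].
apply/eqP; rewrite -subr_eq0 -normr_le0; apply/ler_addgt0Pr => e e0; rewrite add0r.
have e2 : 0 < e / 2 by rewrite divr_gt0.
have cuv : {for x, continuous ('D_u ('D_v f) : _ -> R^o)}.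
  by have [_ /(_ u)] := Df v; apply.
have cvu : {for x, continuous ('D_v ('D_u f) : _ -> R^o)}.
  by have [_ /(_ v)] := Df u; apply.
have Wn : nbhs x W by apply: open_nbhs_nbhs.
have A := (cvgrPdist_lt (FF := nbhs_filter x) _ _).1 cuv _ e2.
have B := (cvgrPdist_lt (FF := nbhs_filter x) _ _).1 cvu _ e2.
have [d /= d0 dB] := (nbhs_ballP _ _).1 (filterI Wn (filterI A B)).
have WB y : ball x d y -> W y by case/dB.
have AB y : ball x d y -> `|'D_u ('D_v f) x - 'D_u ('D_v f) y| < e / 2.
  by move=> By; have [_ [Ay _]] := dB y By; exact: Ay.
have BB y : ball x d y -> `|'D_v ('D_u f) x - 'D_v ('D_u f) y| < e / 2.
  by move=> By; have [_ [_ By']] := dB y By; exact: By'.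
(* the extra 1 keeps [N] positive when [u] and [v] both vanish *)
pose N := `|u| + `|v| + 1.
have N0 : 0 < N by rewrite ltr_wpDl // addr_ge0.
pose h := d / (2 * N).
have h0 : 0 < h by rewrite divr_gt0 // mulr_gt0.
have hN : h * N = d / 2 by rewrite /h; field; rewrite gt_eqF.
have hd : h * (`|u| + `|v|) < d.
  apply: (@le_lt_trans _ _ (d / 2)); last by rewrite ltr_pdivrMr // ltr_pMr // ltr1n.
  by rewrite -hN ler_pM2l // lerDl.
have hd' : h * (`|v| + `|u|) < d by rewrite addrC.
have dfB y : ball x d y -> differentiable f y by move=> /WB/df.
have [p Bp Ep] := second_difference h0 hd dfB
  (fun y By => (Df u).1 y (WB y By)).
have [q Bq Eq] := second_difference h0 hd' dfB
  (fun y By => (Df v).1 y (WB y By)).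
have pq : 'D_v ('D_u f) p = 'D_u ('D_v f) q.
  have hn0 : h ^+ 2 != 0 by rewrite expf_neq0 // gt_eqF.
  rewrite (addrAC x (h *: v) (h *: u)) in Eq.
  apply: (mulfI hn0); apply: etrans (esym Ep) (etrans _ Eq).
  by ring.
have Lp := BB p Bp; have Lq := AB q Bq; rewrite pq in Lp.
exact: dist_triangle_half Lq Lp.
Qed.

End SmoothFunctions.

(** * Calculus on the manifold *)

Section ManifoldCalculus.
Context (R : realType) (n : nat) (M : oriented_manifold R n).
Implicit Types (U V : set M) (f : M -> R) (X Y Z : vector_field M)
  (c : chart R n M).

Lemma near_chart U c p : open U -> U p -> cdom c p ->
  \forall y \near cfun c p, U (cinv c y).
Proof.
move=> oU Up cp.
have cc : {for cfun c p, continuous (cinv c)} by apply: cinv_cont; exists p.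
by apply: cc; rewrite cfunK //; apply: open_nbhs_nbhs.
Qed.

Lemma open_chart_image U c : open U -> open (cfun c @` (U `&` cdom c)).
Proof.
move=> oU; rewrite openE => _ [p [Up cp] <-].
have D := near_chart oU Up cp.
have I : nbhs (cfun c p) (cfun c @` cdom c).
  by apply: open_nbhs_nbhs; split; [exact: cimg_open|exists p].
apply: filterS (filterI D I) => y [] Uy [q cq qy].
by exists q; [split; rewrite // -(cfunK cq) qy|].
Qed.

Lemma dv_ext U f f' p v : open U -> U p -> (forall q, U q -> f q = f' q) ->
  dv p v f = dv p v f'.
Proof.
move=> oU Up e; apply: near_eq_derive.
have := near_chart oU Up (chart_at_dom p).
by apply: filterS => y /e.
Qed.

Lemma smooth_on_ext U f f' : open U -> (forall q, U q -> f q = f' q) ->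
  smooth_on U f -> smooth_on U f'.
Proof.
move=> oU e sf c ac k; apply: Ck_ext (sf c ac k); first exact: open_chart_image.
by move=> _ [p [Up cp] <-]; rewrite cfunK // e.
Qed.

Lemma smooth_on_subset U V f : V `<=` U -> smooth_on U f -> smooth_on V f.
Proof.
move=> VU sf c ac k; apply: Ck_subset (sf c ac k).
by move=> _ [p [Vp cp] <-]; exists p => //; split=> //; apply: VU.
Qed.

Lemma smooth_on_cst U (a : R) : smooth_on U (fun=> a).
Proof. by move=> c ac k; apply: Ck_cst. Qed.

Lemma smooth_on_add U f f' : open U -> smooth_on U f -> smooth_on U f' ->
  smooth_on U (fun p => f p + f' p).
Proof.
move=> oU sf sf' c ac k; apply: Ck_add; [exact: open_chart_image|exact: sf|exact: sf'].
Qed.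

Lemma smooth_on_mul U f f' : open U -> smooth_on U f -> smooth_on U f' ->
  smooth_on U (fun p => f p * f' p).
Proof.
move=> oU sf sf' c ac k; apply: Ck_mul; [exact: open_chart_image|exact: sf|exact: sf'].
Qed.

Lemma smooth_on_opp U f : open U -> smooth_on U f -> smooth_on U (fun p => - f p).
Proof.
move=> oU sf; apply: smooth_on_ext (smooth_on_mul oU (smooth_on_cst U (-1)) sf) => //.
by move=> q _; rewrite mulN1r.
Qed.

Lemma smooth_on_sub U f f' : open U -> smooth_on U f -> smooth_on U f' ->
  smooth_on U (fun p => f p - f' p).
Proof. by move=> oU sf sf'; apply: smooth_on_add => //; apply: smooth_on_opp. Qed.

Lemma smooth_on_coord c k : atlas c -> smooth_on (cdom c) (fun q => cfun c q ord0 k).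
Proof. by move=> ac d ad; rewrite setIC; apply: transition_smooth. Qed.

Lemma smooth_differentiable U f c p : smooth_on U f -> atlas c -> U p -> cdom c p ->
  differentiable (fun y => f (cinv c y) : R^o) (cfun c p).
Proof. by move=> sf ac Up cp; have [+ _] := sf c ac 1; apply; exists p. Qed.

(** The derivative rules are stated for functions differentiable in the chart
    preferred at [p] because they must also apply to [partial], whose
    smoothness is only known in one chart. *)
Definition differentiable_at (p : M) f :=
  differentiable (fun y => f (cinv (chart_at p) y) : R^o) (cfun (chart_at p) p).

Lemma smooth_differentiable_at U f p : U p -> smooth_on U f ->
  differentiable_at p f.
Proof.
move=> Up sf; apply: smooth_differentiable sf _ Up _; first exact: chart_at_atlas.
exact: chart_at_dom.
Qed.

Section AtPoint.
Context (p : M) (v : 'rV[R]_n).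

Lemma differentiable_at_cst (a : R) : differentiable_at p (fun=> a).
Proof. exact: differentiable_cst. Qed.

Lemma differentiable_at_add f f' : differentiable_at p f -> differentiable_at p f' ->
  differentiable_at p (fun q => f q + f' q).
Proof. by move=> df df'; apply: differentiableD. Qed.

Lemma differentiable_at_mul f f' : differentiable_at p f -> differentiable_at p f' ->
  differentiable_at p (fun q => f q * f' q).
Proof. by move=> df df'; apply: differentiableM. Qed.

Lemma dv_cst (a : R) : dv p v (fun=> a) = 0.
Proof. exact: derive_cst. Qed.

Lemma dv_add f f' : differentiable_at p f -> differentiable_at p f' ->
  dv p v (fun q => f q + f' q) = dv p v f + dv p v f'.
Proof. by move=> df df'; rewrite /dv -deriveD //; apply: diff_derivable. Qed.

Lemma dv_mul f f' : differentiable_at p f -> differentiable_at p f' ->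
  dv p v (fun q => f q * f' q) = dv p v f * f' p + f p * dv p v f'.
Proof.
move=> df df'; rewrite /dv.
transitivity ('D_v ((fun y => f (cinv (chart_at p) y) : R^o)
  * (fun y => f' (cinv (chart_at p) y) : R^o)) (cfun (chart_at p) p)) => //.
rewrite deriveM; [|exact: diff_derivable|exact: diff_derivable].
rewrite (cfunK (chart_at_dom p)) [LHS]addrC; congr (_ + _).
exact: mulrC.
Qed.

Lemma dv_linear f t w : differentiable_at p f ->
  dv p (t *: v + w) f = t * dv p v f + dv p w f.
Proof. by move=> df; rewrite /dv !deriveE // linearD linearZ. Qed.

Lemma dv_scale f (a : R) : differentiable_at p f ->
  dv p v (fun q => a * f q) = a * dv p v f.
Proof.
by move=> df; rewrite (dv_mul (differentiable_at_cst a) df) dv_cst mul0r add0r.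
Qed.

Lemma dv_opp f : differentiable_at p f -> dv p v (fun q => - f q) = - dv p v f.
Proof.
move=> df; rewrite -mulN1r -dv_scale //.
by under [fun q => - f q]funext => q do rewrite -mulN1r.
Qed.

Lemma dv_sub f f' : differentiable_at p f -> differentiable_at p f' ->
  dv p v (fun q => f q - f' q) = dv p v f - dv p v f'.
Proof.
by move=> df df'; rewrite -dv_opp // dv_add //; apply: differentiableN.
Qed.

Lemma dv_sum (I : Type) (s : seq I) (P : pred I) (F : I -> M -> R) :
  (forall i, P i -> differentiable_at p (F i)) ->
  differentiable_at p (fun q => \sum_(i <- s | P i) F i q) /\
  dv p v (fun q => \sum_(i <- s | P i) F i q) = \sum_(i <- s | P i) dv p v (F i).
Proof.
move=> dF; elim: s => [|i s [IHd IH]].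
  under [fun q => _]funext => q do rewrite big_nil.
  by rewrite big_nil; split; [exact: differentiable_at_cst|exact: dv_cst].
case Pi : (P i); under [fun q => _]funext => q do rewrite big_cons Pi; last first.
  by rewrite big_cons Pi.
rewrite big_cons Pi -IH; split; last by rewrite dv_add //; apply: dF.
by apply: differentiable_at_add => //; apply: dF.
Qed.

End AtPoint.

Definition partial c k f : M -> R := fun q =>
  'D_(delta_mx ord0 k) (fun y => f (cinv c y) : R^o) (cfun c q).

(** [dv] at [q] is computed in the chart preferred at [q], which changes with
    [q] without any regularity. This formula re-expresses it in one fixed chart,
    and so makes [dv] along a vector field accessible to differentiation. *)
Lemma dv_chart U c p v f : open U -> U p -> smooth_on U f -> atlas c -> cdom c p ->
  dv p v f = \sum_k dv p v (fun q => cfun c q ord0 k) * partial c k f p.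
Proof.
move=> oU Up sf ac cp; have pp := chart_at_dom p; have ap := chart_at_atlas p.
rewrite /dv; set d := chart_at p.
transitivity ('D_v (fun y => (fun z => f (cinv c z)) (cfun c (cinv d y)) : R^o) (cfun d p)).
  apply: near_eq_derive.
  have := near_chart (@cdom_open _ _ _ c) cp pp.
  by apply: filterS => y cy; rewrite cfunK.
rewrite (@derive_comp_row _ _ _ (fun y => cfun c (cinv d y))
  (fun z => f (cinv c z) : R^o)).
- by under eq_bigr do rewrite /d cfunK //.
- by move=> k; apply: smooth_differentiable (smooth_on_coord k ac) ap cp pp.
- by rewrite /d cfunK //; apply: smooth_differentiable sf ac Up cp.
Qed.

Lemma dv_coord_at (p : M) v k : dv p v (fun q => cfun (chart_at p) q ord0 k) = v ord0 k.
Proof.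
rewrite /dv; have pp := chart_at_dom p.
transitivity ('D_v (fun y : 'rV[R]_n => y ord0 k : R^o) (cfun (chart_at p) p)).
  apply: near_eq_derive.
  have I : nbhs (cfun (chart_at p) p) (cfun (chart_at p) @` cdom (chart_at p)).
    by apply: open_nbhs_nbhs; split; [exact: cimg_open|exists p].
  by apply: filterS I => _ [q cq <-]; rewrite cfunK.
have := @derive_mx R _ _ _ (id : 'rV[R]_n -> 'rV[R]_n) (cfun (chart_at p) p) v.
move=> /(_ (@derivable_id _ _ _ _)) /(congr1 (fun A : 'rV[R]_n => A ord0 k)).
by rewrite mxE derive_id => ->.
Qed.

Lemma smooth_on_partial U c k f : smooth_on U f -> atlas c -> open U ->
  Cinfty (cfun c @` (U `&` cdom c)) (fun y => partial c k f (cinv c y)).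
Proof.
move=> sf ac oU j; have [_ /(_ (delta_mx ord0 k))] := sf c ac j.+1.
apply: Ck_ext; first exact: open_chart_image.
by move=> _ [p [Up cp] <-]; rewrite /partial cfunK.
Qed.

Lemma smooth_dv U X f : open U -> smooth_vector_field U X -> smooth_on U f ->
  smooth_on U (fun p => dv p (X p) f).
Proof.
move=> oU sX sf c ac j.
pose W := cfun c @` (U `&` cdom c).
have oW : open W by exact: open_chart_image.
have sx k : Ck j W (fun y => dv (cinv c y) (X (cinv c y)) (fun q => cfun c q ord0 k)).
  by apply: Ck_subset (sX c ac k c ac j) => _ [p [Up cp] <-]; exists p.
have sS (s : seq 'I_n) : Ck j W (fun y => \sum_(k <- s)
    (dv (cinv c y) (X (cinv c y)) (fun q => cfun c q ord0 k) * partial c k f (cinv c y)) : R^o).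
  elim: s => [|k s IH].
    by apply: Ck_ext (Ck_cst j W 0) => // y _; rewrite big_nil.
  apply: Ck_ext (Ck_add oW (Ck_mul oW (sx k) (smooth_on_partial k sf ac oU j)) IH) => //.
  by move=> y _; rewrite big_cons.
apply: Ck_ext (sS (index_enum 'I_n)) => // _ [p [Up cp] <-].
by rewrite cfunK // (dv_chart _ oU Up sf ac cp).
Qed.

Lemma dv_partial U p v k f : open U -> U p -> smooth_on U f ->
  differentiable_at p (partial (chart_at p) k f) /\
  dv p v (partial (chart_at p) k f)
    = \sum_l v ord0 l * ('D_(delta_mx ord0 l) ('D_(delta_mx ord0 k)
        (fun y => f (cinv (chart_at p) y) : R^o)) (cfun (chart_at p) p)).
Proof.
move=> oU Up sf; have ac := chart_at_atlas p; have cp := chart_at_dom p.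
set c := chart_at p in ac cp *; set y0 := cfun c p.
pose F := 'D_(delta_mx ord0 k) (fun y => f (cinv c y) : R^o).
have dF : differentiable (F : _ -> R^o) y0.
  have [_ /(_ (delta_mx ord0 k)) [+ _]] := sf c ac 2; apply.
  by exists p.
have e : \forall y \near y0, F y = partial c k f (cinv c y).
  have I : nbhs y0 (cfun c @` cdom c).
    by apply: open_nbhs_nbhs; split; [exact: cimg_open|exists p].
  by apply: filterS I => _ [q cq <-]; rewrite /partial cfunK.
split; first exact: near_differentiable e dF.
rewrite /dv -/c -/y0 -(near_eq_derive _ e) deriveE // [in LHS](row_sum_delta v) linear_sum.
by apply: eq_bigr => l _; rewrite linearZ /= deriveE.
Qed.

(** In the chart preferred at [p], the second derivatives of [f] enter
    [X (Y f)] and [Y (X f)] through the same symmetric Hessian and cancel; the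
    first derivatives that remain have the components of the bracket as
    coefficients. *)
Lemma dv_lie U X Y f p : open U -> smooth_vector_field U X ->
  smooth_vector_field U Y -> smooth_on U f -> U p ->
  dv p (lie X Y p) f
    = dv p (X p) (fun q => dv q (Y q) f) - dv p (Y p) (fun q => dv q (X q) f).
Proof.
move=> oU sX sY sf Up; have ac := chart_at_atlas p; have cp := chart_at_dom p.
set c := chart_at p in ac cp *.
pose x k : M -> R := fun q => cfun c q ord0 k.
pose H l k := 'D_(delta_mx ord0 l) ('D_(delta_mx ord0 k)
        (fun y => f (cinv c y) : R^o)) (cfun c p).
have oV : open (U `&` cdom c) by apply: openI => //; exact: cdom_open.
have Vp : (U `&` cdom c) p by [].
have second (Z T : vector_field M) : smooth_vector_field U T ->
    dv p (Z p) (fun q => dv q (T q) f)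
  = \sum_k dv p (Z p) (fun q => dv q (T q) (x k)) * partial c k f p
    + \sum_k \sum_l T p ord0 k * Z p ord0 l * H l k.
  move=> sT.
  rewrite (dv_ext (Z p) oV Vp (f' := fun q => \sum_k dv q (T q) (x k) * partial c k f q));
    last by move=> q [Uq cq]; exact: dv_chart oU Uq sf ac cq.
  have dx k : differentiable_at p (fun q => dv q (T q) (x k)).
    exact: smooth_differentiable_at Vp (sT c ac k).
  have dP k := (dv_partial (Z p) k oU Up sf).1.
  rewrite (dv_sum (Z p) _ (P := xpredT) (fun k _ => differentiable_at_mul (dx k) (dP k))).2.
  rewrite -big_split; apply: eq_bigr => k _ /=.
  rewrite dv_mul // (dv_partial (Z p) k oU Up sf).2 dv_coord_at mulr_sumr.
  by congr (_ + _); apply: eq_bigr => l _; rewrite mulrA.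
have Hsym k l : H k l = H l k.
  apply: (@derive_sym _ _ (cfun c @` (U `&` cdom c))); first exact: open_chart_image.
    by exists p.
  exact: sf c ac 2.
clearbody H.
rewrite (second X Y) // (second Y X) //.
rewrite (dv_chart _ oU Up sf ac cp).
have -> : \sum_k \sum_l Y p ord0 k * X p ord0 l * H l k
        = \sum_k \sum_l X p ord0 k * Y p ord0 l * H l k.
  rewrite exchange_big; apply: eq_bigr => k _; apply: eq_bigr => l _.
  by rewrite Hsym (mulrC (Y p ord0 l)).
have cancel (a b d : R) : a - b = a + d - (b + d) by ring.
apply: etrans (cancel _ _ _); rewrite -sumrB; apply: eq_bigr => k _.
by rewrite -mulrBl; congr (_ * _); rewrite dv_coord_at mxE.
Qed.

Lemma smooth_vf_subset U V X : V `<=` U -> smooth_vector_field U X ->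
  smooth_vector_field V X.
Proof.
move=> VU sX c ac k; apply: smooth_on_subset (sX c ac k) => q [Vq cq].
by split=> //; apply: VU.
Qed.

Lemma open_dom U c : open U -> open (U `&` cdom c).
Proof. by move=> oU; apply: openI => //; exact: cdom_open. Qed.

Lemma smooth_vf_ext U X Y : open U -> (forall q, U q -> X q = Y q) ->
  smooth_vector_field U X -> smooth_vector_field U Y.
Proof.
move=> oU e sX c ac k; apply: smooth_on_ext (sX c ac k); first exact: open_dom.
by move=> q [Uq _]; rewrite e.
Qed.

Lemma smooth_vf_comb U f X Y : open U -> smooth_on U f ->
  smooth_vector_field U X -> smooth_vector_field U Y ->
  smooth_vector_field U (fun q => f q *: X q + Y q).
Proof.
move=> oU sf sX sY c ac k; have oV := open_dom c oU.
have sf' : smooth_on (U `&` cdom c) f by apply: smooth_on_subset sf => q [].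
apply: smooth_on_ext (smooth_on_add oV (smooth_on_mul oV sf' (sX c ac k)) (sY c ac k)) => //.
move=> q [Uq cq]; rewrite dv_linear //.
exact: smooth_differentiable_at cq (smooth_on_coord k ac).
Qed.

Lemma smooth_vf0 U : open U -> smooth_vector_field U (fun=> 0 : 'rV[R]_n).
Proof.
move=> oU c ac k; apply: smooth_on_ext (smooth_on_cst _ 0); first exact: open_dom.
move=> q [Uq cq]; rewrite /dv deriveE ?linear0 //.
exact: smooth_differentiable_at cq (smooth_on_coord k ac).
Qed.

Lemma smooth_vf_scale U f X : open U -> smooth_on U f ->
  smooth_vector_field U X -> smooth_vector_field U (fun q => f q *: X q).
Proof.
move=> oU sf sX; apply: smooth_vf_ext (smooth_vf_comb oU sf sX (smooth_vf0 oU)) => //.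
by move=> q _; rewrite addr0.
Qed.

Lemma smooth_vf_add U X Y : open U ->
  smooth_vector_field U X -> smooth_vector_field U Y ->
  smooth_vector_field U (fun q => X q + Y q).
Proof.
move=> oU sX sY; apply: smooth_vf_ext (smooth_vf_comb oU (smooth_on_cst U 1) sX sY) => //.
by move=> q _; rewrite scale1r.
Qed.

Lemma smooth_vf_sub U X Y : open U ->
  smooth_vector_field U X -> smooth_vector_field U Y ->
  smooth_vector_field U (fun q => X q - Y q).
Proof.
move=> oU sX sY; apply: smooth_vf_ext (smooth_vf_comb oU (smooth_on_cst U (-1)) sY sX) => //.
by move=> q _; rewrite scaleN1r addrC.
Qed.

Lemma lie_antisym X Y p : lie X Y p = - lie Y X p.
Proof. by apply/rowP => k; rewrite !mxE opprB. Qed.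

Lemma tangent_eq (p : M) (v w : 'rV[R]_n) :
  (forall k, dv p v (fun q => cfun (chart_at p) q ord0 k)
           = dv p w (fun q => cfun (chart_at p) q ord0 k)) -> v = w.
Proof. by move=> e; apply/rowP => k; have := e k; rewrite !dv_coord_at. Qed.

(** A tangent vector is determined by the derivatives of the coordinates, and
    on functions the double brackets expand into triple derivatives that cancel
    in the cyclic sum. Smoothness of the inner brackets is a hypothesis: it is
    supplied below by the Levi-Civita connection. *)
Lemma lie_jacobi U X Y Z p : open U -> U p ->
  smooth_vector_field U X -> smooth_vector_field U Y -> smooth_vector_field U Z ->
  smooth_vector_field U (lie X Y) -> smooth_vector_field U (lie Y Z) ->
  smooth_vector_field U (lie Z X) ->
  lie X (lie Y Z) p + lie Y (lie Z X) p + lie Z (lie X Y) p = 0.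
Proof.
move=> oU Up sX sY sZ sXY sYZ sZX.
have oV := open_dom (chart_at p) oU; have cp := chart_at_dom p.
have Vp : (U `&` cdom (chart_at p)) p by [].
have sub : U `&` cdom (chart_at p) `<=` U by move=> q [].
apply: (tangent_eq (p := p)) => k; set x := (fun q => cfun (chart_at p) q ord0 k).
have sx : smooth_on (U `&` cdom (chart_at p)) x.
  apply: smooth_on_subset (smooth_on_coord k (chart_at_atlas p)); by move=> q [].
have dx := smooth_differentiable_at Vp sx.
have D A B : smooth_vector_field U A -> smooth_vector_field U B ->
   smooth_on (U `&` cdom (chart_at p)) (fun q => dv q (A q) (fun r => dv r (B r) x)).
  move=> sA sB; apply: (smooth_dv oV (smooth_vf_subset sub sA)).
  exact: (smooth_dv oV (smooth_vf_subset sub sB) sx).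
pose T (A B C : vector_field M) := dv p (A p) (fun q => dv q (B q) (fun r => dv r (C r) x)).
have L A B C : smooth_vector_field U A -> smooth_vector_field U B ->
    smooth_vector_field U C -> smooth_vector_field U (lie B C) ->
  dv p (lie A (lie B C) p) x = T A B C - T A C B - (T B C A - T C B A).
  move=> sA sB sC sBC.
  have sV F (sF : smooth_vector_field U F) := smooth_vf_subset sub sF.
  rewrite (dv_lie oV (sV _ sA) (sV _ sBC) sx Vp); congr (_ - _).
    rewrite (dv_ext (A p) oV Vp (fun q Vq => dv_lie oV (sV _ sB) (sV _ sC) sx Vq)).
    by apply: dv_sub; apply: smooth_differentiable_at Vp _; apply: D.
  rewrite (dv_lie oV (sV _ sB) (sV _ sC) _ Vp) //.
  by apply: (smooth_dv oV _ sx); exact: sV.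
have addv v w : dv p (v + w) x = dv p v x + dv p w x.
  by rewrite -{1}(scale1r v) dv_linear // mul1r.
have dv0 : dv p 0 x = 0 by rewrite /dv derive0.
clearbody T; rewrite addv addv dv0.
have e1 := L X Y Z sX sY sZ sYZ; have e2 := L Y Z X sY sZ sX sZX.
have e3 := L Z X Y sZ sX sY sXY.
apply: etrans (f_equal2 +%R (f_equal2 +%R e1 e2) e3) _; ring.
Qed.

End ManifoldCalculus.

(** * Locality, structure equations and the Bianchi identity *)

Section LeviCivita.
Context (R : realType) (n : nat) (M : oriented_manifold R n).
Context (g : riemannian_metric M) (lc : levi_civita g).
Implicit Types (U V : set M) (f : M -> R) (X Y Z : vector_field M).

Lemma metricDl p u v w : g p (u + v) w = g p u w + g p v w.
Proof. by rewrite -{1}(scale1r u) metric_linear mul1r. Qed.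

Lemma metric0l p w : g p 0 w = 0.
Proof. by apply: (addrI (g p 0 w)); rewrite -metricDl !addr0. Qed.

Lemma metricZl p t u w : g p (t *: u) w = t * g p u w.
Proof. by rewrite -(addr0 (t *: u)) metric_linear metric0l addr0. Qed.

Lemma metricNl p u w : g p (- u) w = - g p u w.
Proof. by rewrite -scaleN1r metricZl mulN1r. Qed.

Lemma metricBl p u v w : g p (u - v) w = g p u w - g p v w.
Proof. by rewrite metricDl metricNl. Qed.

Lemma metric_suml p (I : Type) (s : seq I) (F : I -> 'rV[R]_n) w :
  g p (\sum_(i <- s) F i) w = \sum_(i <- s) g p (F i) w.
Proof.
elim: s => [|i s IH]; first by rewrite !big_nil metric0l.
by rewrite !big_cons metricDl IH.
Qed.

(** The Leibniz rule alone makes [nabla] local: the indicator function of an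
    open set [U] is smooth on [U], so it may serve as the cut-off function. *)
Lemma nabla_ext U Y Y' p v : open U -> U p -> smooth_vector_field U Y ->
  (forall q, U q -> Y q = Y' q) -> lc p v Y = lc p v Y'.
Proof.
move=> oU Up sY e.
pose chi (q : M) : R := if `[< U q >] then 1 else 0.
have chi1 q : U q -> chi q = 1 by move=> Uq; rewrite /chi asboolT.
have schi : smooth_on U chi.
  by apply: smooth_on_ext (smooth_on_cst U 1) => // q /chi1.
have dchi : dv p v chi = 0 by rewrite (dv_ext v oU Up chi1) dv_cst.
have L Z : smooth_vector_field U Z -> lc p v (fun q => chi q *: Z q) = lc p v Z.
  move=> sZ; rewrite (nabla_leibniz lc oU schi sZ Up) dchi scale0r add0r.
  by rewrite chi1 // scale1r.
rewrite -(L Y sY) -(L Y' (smooth_vf_ext oU e sY)); congr (lc p v _).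
apply/funext => q; rewrite /chi; case: asboolP => [/e ->//|_].
by rewrite !scale0r.
Qed.

Lemma nabla_scale U f Y p v : open U -> U p -> smooth_on U f ->
  smooth_vector_field U Y ->
  lc p v (fun q => f q *: Y q) = dv p v f *: Y p + f p *: lc p v Y.
Proof. by move=> oU Up sf sY; exact: (nabla_leibniz lc oU sf sY Up). Qed.

Lemma nabla_sub U Y Z p v : open U -> U p -> smooth_vector_field U Y ->
  smooth_vector_field U Z ->
  lc p v (fun q => Y q - Z q) = lc p v Y - lc p v Z.
Proof.
move=> oU Up sY sZ.
have sN : smooth_vector_field U (fun q => -1 *: Z q).
  exact: smooth_vf_scale (smooth_on_cst U (-1)) sZ.
transitivity (lc p v (fun q => Y q + (-1) *: Z q)).
  by congr (lc p v _); apply/funext => q; rewrite scaleN1r.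
rewrite (nabla_add lc oU sY sN Up) (nabla_scale _ oU Up (smooth_on_cst U (-1)) sZ).
by rewrite dv_cst scale0r add0r scaleN1r.
Qed.

Lemma nabla_comb U (m : nat) (f : 'I_m -> M -> R) (E : 'I_m -> vector_field M) p v :
  open U -> U p -> (forall l, smooth_on U (f l)) ->
  (forall l, smooth_vector_field U (E l)) ->
  lc p v (fun q => \sum_l f l q *: E l q)
    = \sum_l (dv p v (f l) *: E l p + f l p *: lc p v (E l)).
Proof.
move=> oU Up sf sE.
have H (s : seq 'I_m) : smooth_vector_field U (fun q => \sum_(l <- s) f l q *: E l q) /\
  lc p v (fun q => \sum_(l <- s) f l q *: E l q)
    = \sum_(l <- s) (dv p v (f l) *: E l p + f l p *: lc p v (E l)).
  elim: s => [|l s [IHs IH]].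
    split; first by apply: smooth_vf_ext (smooth_vf0 oU) => // q _; rewrite big_nil.
    transitivity (lc p v (fun q => 0 *: (fun=> 0 : 'rV[R]_n) q)).
      by congr (lc p v _); apply/funext => q; rewrite big_nil scale0r.
    rewrite (nabla_scale _ oU Up (smooth_on_cst U 0) (smooth_vf0 oU)).
    by rewrite big_nil scaler0 scale0r addr0.
  have sl := smooth_vf_scale oU (sf l) (sE l).
  under [fun q => _]funext => q do rewrite big_cons.
  split; first exact: (smooth_vf_add oU sl IHs).
  apply: etrans (nabla_add lc oU sl IHs Up v) _; rewrite IH big_cons.
  by apply: (f_equal2 +%R _ (erefl _)); exact: (nabla_scale v oU Up (sf l) (sE l)).
by have [_ ->] := H (index_enum 'I_m).
Qed.

Lemma nablaNv U Y p v : open U -> U p -> smooth_vector_field U Y ->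
  lc p (- v) Y = - lc p v Y.
Proof.
move=> oU Up sY; have L := nabla_linear lc oU sY Up.
have l0 : lc p 0 Y = 0.
  by have := L 1 0 0; rewrite !scale1r addr0 => /esym/(canRL (addrK _)); rewrite subrr.
by rewrite -scaleN1r -[-1 *: v]addr0 L l0 addr0 scaleN1r.
Qed.

Lemma riem_antisym U X Y Z p : open U -> U p -> smooth_vector_field U Z ->
  riem lc X Y Z p = - riem lc Y X Z p.
Proof.
move=> oU Up sZ; rewrite /riem (lie_antisym X Y) (nablaNv _ oU Up sZ).
by rewrite opprK !opprB addrC.
Qed.

(** Vanishing torsion exhibits the bracket as a difference of smooth fields. *)
Lemma smooth_vf_lie U X Y : open U -> smooth_vector_field U X ->
  smooth_vector_field U Y -> smooth_vector_field U (lie X Y).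
Proof.
move=> oU sX sY.
apply: smooth_vf_ext (smooth_vf_sub oU (nabla_smooth lc oU sX sY) (nabla_smooth lc oU sY sX)) => //.
by move=> q Uq; exact: (nabla_torsion_free lc oU sX sY Uq).
Qed.

(** First Bianchi identity: torsion-freeness turns the cyclic sum of the
    curvature into the cyclic sum of the double brackets. *)
Lemma riem_bianchi U X Y Z p : open U -> U p -> smooth_vector_field U X ->
  smooth_vector_field U Y -> smooth_vector_field U Z ->
  riem lc X Y Z p + riem lc Y Z X p + riem lc Z X Y p = 0.
Proof.
move=> oU Up sX sY sZ.
have sL A B := @smooth_vf_lie U A B oU.
have sN A B := nabla_smooth lc oU (X := A) (Y := B).
have T A B C : smooth_vector_field U A -> smooth_vector_field U B ->
    smooth_vector_field U C ->
    lc p (A p) (fun q => lc q (B q) C) - lc p (A p) (fun q => lc q (C q) B)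
    - lc p (lie B C p) A = lie A (lie B C) p.
  move=> sA sB sC.
  rewrite -(nabla_torsion_free lc oU sA (sL _ _ sB sC) Up); congr (_ - _).
  rewrite -(nabla_sub _ oU Up (sN _ _ sB sC) (sN _ _ sC sB)).
  apply: (nabla_ext _ oU Up).
    exact: smooth_vf_sub (sN _ _ sB sC) (sN _ _ sC sB).
  by move=> q Uq; exact: (nabla_torsion_free lc oU sB sC Uq).
have J := lie_jacobi oU Up sX sY sZ (sL _ _ sX sY) (sL _ _ sY sZ) (sL _ _ sZ sX).
have e1 := T X Y Z sX sY sZ; have e2 := T Y Z X sY sZ sX; have e3 := T Z X Y sZ sX sY.
have J' := etrans (f_equal2 +%R (f_equal2 +%R e1 e2) e3) J.
rewrite -J' /riem.
pose S (A B C : vector_field M) := lc p (A p) (fun q => lc q (B q) C).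
rewrite -!/(S _ _ _).
apply/eqP; rewrite -subr_eq0; apply/eqP/rowP => k; rewrite !mxE; ring.
Qed.

(** The curvature matrix [dw(X, Y) + w(Y) w(X) - w(X) w(Y)] of the connection
    [nabla f_k = sum_l w_kl f_l], whose coefficients act on row vectors. *)
Definition form_curv (m : nat) (w : M -> 'rV[R]_n -> 'M[R]_m) X Y (p : M) : 'M[R]_m :=
  \matrix_(k, l) (dv p (X p) (fun q => w q (Y q) k l)
                  - dv p (Y p) (fun q => w q (X q) k l))
  - w p (lie X Y p) + (w p (Y p) *m w p (X p) - w p (X p) *m w p (Y p)).

Lemma form_curv_skew (m : nat) (w : M -> 'rV[R]_n -> 'M[R]_m) U X Y p :
  open U -> U p -> (forall q v, U q -> (w q v)^T = - w q v) ->
  (forall k l, smooth_on U (fun q => w q (X q) k l)) ->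
  (forall k l, smooth_on U (fun q => w q (Y q) k l)) ->
  (form_curv w X Y p)^T = - form_curv w X Y p.
Proof.
move=> oU Up sk sX sY.
have skE q v k l : U q -> w q v k l = - w q v l k.
  by move=> Uq; have := congr1 (fun A : 'M[R]_m => A l k) (sk q v Uq); rewrite !mxE => ->.
have dE (Z T : vector_field M) k l : (forall k l, smooth_on U (fun q => w q (T q) k l)) ->
    dv p (Z p) (fun q => w q (T q) k l) = - dv p (Z p) (fun q => w q (T q) l k).
  move=> sT; rewrite (dv_ext _ oU Up (fun q Uq => skE q (T q) k l Uq)).
  by rewrite dv_opp //; apply: smooth_differentiable_at Up _.
rewrite /form_curv [LHS]linearD [X in X + _ = _]linearB /= linearB /= !trmx_mul !sk //.
rewrite !mulNmx !mulmxN !opprK.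
apply/matrixP => k l; rewrite !mxE (dE X Y l k sY) (dE Y X l k sX); ring.
Qed.

Section Frame.
Context (U : set M) (E : 'I_n -> vector_field M).
Hypotheses (oU : open U) (sE : forall i, smooth_vector_field U (E i)).
Hypothesis ortho : forall x, U x -> forall i j, g x (E i x) (E j x) = (i == j)%:R.
Hypothesis spanE : forall x, U x -> forall v, v = \sum_j g x v (E j x) *: E j x.

Definition conn_form (x : M) (v : 'rV[R]_n) : 'M[R]_n :=
  \matrix_(i, j) g x (lc x v (E i)) (E j x).

Lemma conn_form_linear x t v w : U x ->
  conn_form x (t *: v + w) = t *: conn_form x v + conn_form x w.
Proof.
move=> Ux; apply/matrixP => i j; rewrite !mxE (nabla_linear lc oU (sE i) Ux).
by rewrite metricDl metricZl.
Qed.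

Lemma conn_form_skew x v : U x -> (conn_form x v)^T = - conn_form x v.
Proof.
move=> Ux; apply/matrixP => i j; rewrite !mxE.
have := nabla_metric lc oU (sE i) (sE j) Ux v.
rewrite (dv_ext v oU Ux (fun q Uq => ortho Uq i j)) dv_cst [g x (E i x) _](Defs.metric_sym g).
by move/esym/eqP; rewrite addrC addr_eq0 => /eqP.
Qed.

Lemma smooth_conn_form X i j : smooth_vector_field U X ->
  smooth_on U (fun x => conn_form x (X x) i j).
Proof.
move=> sX; apply: smooth_on_ext (metric_smooth g oU (nabla_smooth lc oU sX (sE i)) (sE j)) => //.
by move=> q _; rewrite mxE.
Qed.

Lemma nabla_frame x v i : U x -> lc x v (E i) = \sum_j conn_form x v i j *: E j x.
Proof. by move=> Ux; rewrite {1}(spanE Ux (lc x v (E i))); apply: eq_bigr => j _; rewrite mxE. Qed.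

(** Cartan's second structure equation: differentiate
    [nabla e_k = sum_l w_kl e_l] once more, which is legitimate although this
    equality holds on [U] only because [nabla] is local. *)
Lemma riem_form_curv X Y k l x : U x -> smooth_vector_field U X ->
  smooth_vector_field U Y ->
  g x (riem lc X Y (E k) x) (E l x) = form_curv conn_form X Y x k l.
Proof.
move=> Ux sX sY.
have N (Z T : vector_field M) : smooth_vector_field U T ->
    g x (lc x (Z x) (fun q => lc q (T q) (E k))) (E l x)
    = dv x (Z x) (fun q => conn_form q (T q) k l)
      + (conn_form x (T x) *m conn_form x (Z x)) k l.
  move=> sT.
  rewrite (nabla_ext (Z x) oU Ux (nabla_smooth lc oU sT (sE k))
    (fun q Uq => nabla_frame (T q) k Uq)).
  rewrite (nabla_comb (Z x) (f := fun j q => conn_form q (T q) k j) oU Ux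
    (fun j => smooth_conn_form k j sT) sE).
  rewrite metric_suml mxE.
  under eq_bigr do rewrite metricDl !metricZl ortho //.
  rewrite big_split /=; congr (_ + _).
    rewrite (bigD1 l) //= eqxx mulr1 big1 ?addr0 // => j jl.
    by rewrite (negPf jl) mulr0.
  by apply: eq_bigr => j _; rewrite mxE [in RHS]mxE.
rewrite /riem !metricBl N // N // /form_curv.
have -> : g x (lc x (lie X Y x) (E k)) (E l x) = conn_form x (lie X Y x) k l by rewrite mxE.
set A := conn_form x _ *m _; set B := conn_form x _ *m _; set D := conn_form x (lie _ _ _).
clearbody A B D; rewrite !mxE; ring.
Qed.

Lemma frame_torsion i j k x : U x ->
  g x (lie (E i) (E j) x) (E k x) = conn_form x (E i x) j k - conn_form x (E j x) i k.
Proof.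
by move=> Ux; rewrite -(nabla_torsion_free lc oU (sE i) (sE j) Ux) metricBl !mxE.
Qed.

End Frame.

End LeviCivita.

Lemma Theta_form_curv (R : realType) (n : nat) (M : oriented_manifold R n) (r : nat)
  (Q : principal_bundle M (SO_group R r)) (th : SO_connection Q) (f : M -> Q)
  k l (X Y : vector_field M) (p : M) :
  Theta th f k l X Y p = form_curv (th f) X Y p k l.
Proof.
have N q v : nablaF th f q v (fun=> delta_mx ord0 k) = row k (th f q v).
  by rewrite /nablaF -rowE; apply/rowP => j; rewrite !mxE dv_cst add0r.
have N2 q v (T : vector_field M) j :
    nablaF th f q v (fun q => nablaF th f q (T q) (fun=> delta_mx ord0 k)) ord0 j
    = dv q v (fun q => th f q (T q) k j) + (th f q (T q) *m th f q v) k j.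
  rewrite {1}/nablaF N -row_mul [LHS]mxE [X in _ + X]mxE [X in X + _]mxE.
  by congr (dv _ _ _ + _); apply/funext => q'; rewrite N mxE.
have sub3 (a b c : 'rV[R]_r) : (a - b - c) ord0 l = a ord0 l - b ord0 l - c ord0 l.
  by rewrite !mxE.
rewrite /Theta /curvF sub3 (N2 p (X p) Y) (N2 p (Y p) X) N [row _ _ _ _]mxE.
rewrite /form_curv.
set A := th f p _ *m _; set B := th f p _ *m _; set D := th f p _.
clearbody A B D; rewrite !mxE; ring.
Qed.

(** * Clifford algebra *)

Lemma eq_opp0 (K : numFieldType) (x : K) : x = - x -> x = 0.
Proof.
by move/eqP; rewrite -addr_eq0 -mulr2n mulrn_eq0 => /eqP.
Qed.

Lemma sum_delta (K : pzRingType) (V : lmodType K) (n : nat) (F : 'I_n -> V) m :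
  \sum_j ((j == m)%:R : K) *: F j = F m.
Proof.
rewrite (bigD1 m) //= eqxx scale1r big1 ?addr0 // => j /negPf ->.
by rewrite scale0r.
Qed.

Lemma sum_lt_split (V : zmodType) (n : nat) (F : 'I_n -> 'I_n -> V) :
  \sum_i \sum_j F i j
    = \sum_i F i i + \sum_(i < n) \sum_(j < n | (i < j)%N) (F i j + F j i).
Proof.
have -> : \sum_(i < n) \sum_(j < n | (i < j)%N) (F i j + F j i)
    = \sum_(i < n) \sum_(j < n | (i < j)%N) F i j
      + \sum_(i < n) \sum_(j < n | (j < i)%N) F i j.
  under eq_bigr do rewrite big_split /=.
  rewrite big_split /=; congr (_ + _).
  by rewrite [LHS](exchange_big_dep predT).
rewrite addrC -addrA -big_split -big_split; apply: eq_bigr => i _ /=.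
rewrite (bigID (fun j : 'I_n => (i < j)%N)) /=; congr (_ + _).
rewrite (bigD1 i) /= ?ltnn // addrC; congr (_ + _); apply: eq_bigl => j.
by rewrite -leqNgt [RHS]ltn_neqAle andbC.
Qed.

Lemma sum_lt_half (V : zmodType) (n : nat) (F : 'I_n -> 'I_n -> V) :
  (forall i, F i i = 0) -> (forall i j, F j i = F i j) ->
  (\sum_(i < n) \sum_(j < n | (i < j)%N) F i j) *+ 2 = \sum_i \sum_j F i j.
Proof.
move=> F0 Fs; rewrite sum_lt_split [X in X + _]big1 // add0r mulr2n -big_split.
apply: eq_bigr => i _ /=; rewrite -big_split; apply: eq_bigr => j _ /=.
by rewrite Fs.
Qed.

Section Clifford.
Context (K : numFieldType) (n m : nat) (G : 'I_n -> 'M[K]_m).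
Hypothesis Gcl : forall i j, G j *m G i = - (2 * (i == j)%:R)%:M - G i *m G j.

(** The embedding of [so(n)] into the Clifford algebra, that is the derivative
    of the spin representation. *)
Definition bivector (a : 'I_n -> 'I_n -> K) : 'M[K]_m :=
  2^-1 *: \sum_(i < n) \sum_(j < n | (i < j)%N) a i j *: (G i *m G j).

Lemma bivectorE (a : 'I_n -> 'I_n -> K) : (forall i j, a j i = - a i j) ->
  bivector a = 4^-1 *: \sum_i \sum_j a i j *: (G i *m G j).
Proof.
move=> sk; have a0 i : a i i = 0.
  exact: eq_opp0.
rewrite -sum_lt_half; last first.
- move=> i j; have [->|ij] := eqVneq i j; first by rewrite a0 !scale0r.
  by rewrite sk Gcl (negPf ij) mulr0 raddf0 oppr0 sub0r scaleNr scalerN opprK.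
- by move=> i; rewrite a0 scale0r.
rewrite -[_ *+ 2]scaler_nat scalerA /bivector; congr (_ *: _).
by field.
Qed.

Lemma bivector_comb (t : K) (a b : 'I_n -> 'I_n -> K) :
  bivector (fun i j => t * a i j + b i j) = t *: bivector a + bivector b.
Proof.
rewrite /bivector scalerA [t * _]mulrC -scalerA -scalerDr; congr (_ *: _).
rewrite scaler_sumr -big_split; apply: eq_bigr => i _ /=.
rewrite scaler_sumr -big_split; apply: eq_bigr => j _ /=.
by rewrite scalerDl scalerA.
Qed.

Lemma clifford_commutator i j k :
  G i *m G j *m G k - G k *m (G i *m G j)
    = (2 * (i == k)%:R) *: G j - (2 * (j == k)%:R) *: G i.
Proof.
rewrite mulmxA (Gcl i k) mulmxBl mulNmx mul_scalar_mx -!mulmxA (Gcl j k).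
rewrite mulmxBr mulmxN mul_mx_scalar.
set P := G i *m _; set a := _ *: G j; set b := _ *: G i; clearbody P a b.
by apply/matrixP => p q; rewrite !mxE; ring.
Qed.

(** The infinitesimal form of the double covering [Spin -> SO]. Geometrically
    it says that Clifford multiplication is parallel. *)
Lemma bivector_generator (a : 'I_n -> 'I_n -> K) k : (forall i j, a j i = - a i j) ->
  bivector a *m G k - G k *m bivector a = \sum_l a k l *: G l.
Proof.
move=> sk; rewrite bivectorE // -scalemxAl -scalemxAr -scalerBr.
have -> : (\sum_i \sum_j a i j *: (G i *m G j)) *m G k
        - G k *m (\sum_i \sum_j a i j *: (G i *m G j))
  = \sum_i (i == k)%:R *: (\sum_j (2 * a i j) *: G j)
    - \sum_i \sum_j (j == k)%:R *: ((2 * a i j) *: G i).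
  rewrite mulmx_suml mulmx_sumr -!sumrB; apply: eq_bigr => i _.
  rewrite mulmx_suml mulmx_sumr scaler_sumr -!sumrB; apply: eq_bigr => j _.
  rewrite -scalemxAl -scalemxAr -scalerBr clifford_commutator scalerBr !scalerA.
  by congr (_ *: _ - _ *: _); ring.
rewrite sum_delta; under [X in _ - X]eq_bigr do rewrite sum_delta.
rewrite -sumrB scaler_sumr; apply: eq_bigr => l _.
by rewrite -scalerBl scalerA [a l k]sk; congr (_ *: _); field.
Qed.

(** The bracket is a derivation, so it is determined by its action on the
    generators. The order of the products is reversed since [a] maps [G_k] to
    [sum_l a_kl G_l], that is, coefficient matrices act on rows. *)
Lemma bivector_bracket (a b : 'I_n -> 'I_n -> K) :
  (forall i j, a j i = - a i j) -> (forall i j, b j i = - b i j) ->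
  bivector a *m bivector b - bivector b *m bivector a
    = bivector (fun i j => \sum_l (b i l * a l j - a i l * b l j)).
Proof.
move=> ska skb; set A := bivector a.
have brG k l : A *m (G k *m G l) - (G k *m G l) *m A
    = \sum_p a k p *: (G p *m G l) + \sum_p a l p *: (G k *m G p).
  transitivity ((A *m G k - G k *m A) *m G l + G k *m (A *m G l - G l *m A)).
    rewrite mulmxBl mulmxBr !mulmxA -!mulmxA.
    by apply/matrixP => p q; rewrite !mxE; ring.
  rewrite !bivector_generator // mulmx_suml mulmx_sumr.
  by congr (_ + _); apply: eq_bigr => p _; rewrite -?scalemxAl -?scalemxAr.
clearbody A; rewrite (bivectorE skb) [RHS]bivectorE; last first.
  move=> i j; rewrite -sumrN; apply: eq_bigr => l _.
  by rewrite (skb j l) (ska j l) (ska i l) (skb i l); ring.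
rewrite -scalemxAr -scalemxAl -scalerBr; congr (_ *: _).
rewrite mulmx_sumr mulmx_suml -sumrB.
transitivity (\sum_k \sum_l (\sum_p (b k l * a k p) *: (G p *m G l)
                           + \sum_p (b k l * a l p) *: (G k *m G p))).
  apply: eq_bigr => k _; rewrite mulmx_sumr mulmx_suml -sumrB; apply: eq_bigr => l _.
  rewrite -scalemxAr -scalemxAl -scalerBr brG scalerDr !scaler_sumr.
  by congr (_ + _); apply: eq_bigr => p _; rewrite scalerA.
under eq_bigr do rewrite big_split /=.
rewrite big_split /=.
transitivity (\sum_i \sum_j ((\sum_l - (a i l * b l j)) *: (G i *m G j)
                           + (\sum_l b i l * a l j) *: (G i *m G j))).
  under [RHS]eq_bigr do rewrite big_split /=.
  rewrite [RHS]big_split /=; congr (_ + _).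
    under eq_bigr do rewrite exchange_big /=.
    rewrite exchange_big; apply: eq_bigr => i _ /=.
    rewrite exchange_big; apply: eq_bigr => j _ /=.
    rewrite scaler_suml; apply: eq_bigr => l _; congr (_ *: _).
    by rewrite (ska i l); ring.
  apply: eq_bigr => i _; rewrite exchange_big; apply: eq_bigr => j _ /=.
  by rewrite scaler_suml.
apply: eq_bigr => i _; apply: eq_bigr => j _; rewrite -scalerDl -big_split.
by congr (_ *: _); apply: eq_bigr => l _ /=; ring.
Qed.

Lemma sum3_rot (V : zmodType) (F : 'I_n -> 'I_n -> 'I_n -> V) :
  \sum_i \sum_j \sum_k F j k i = \sum_i \sum_j \sum_k F i j k.
Proof.
rewrite exchange_big; apply: eq_bigr => i _.
by rewrite exchange_big.
Qed.

(** The products [G_i G_j G_k], [G_j G_k G_i] and [G_k G_i G_j] agree up to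
    terms of degree one. Summing the cyclic identity against [G_i G_j G_k] thus
    gives three times the left-hand side plus contractions of [T], which the
    antisymmetry in the first two indices reduces to a single one. *)
Lemma bianchi_contraction (T : 'I_n -> 'I_n -> 'I_n -> K) :
  (forall i j k, T j i k = - T i j k) ->
  (forall i j k, T i j k + T j k i + T k i j = 0) ->
  \sum_i \sum_j \sum_k T i j k *: (G i *m G j *m G k)
    = - 2 *: \sum_i (\sum_j T i j j) *: G i.
Proof.
move=> sk cyc; set Q := LHS; set A := \sum_i _ *: G i.
have T0 i k : T i i k = 0.
  exact: eq_opp0.
pose P i j k := G i *m G j *m G k.
have P1 i j k : P k i j = P i j k + (2 * (j == k)%:R) *: G i - (2 * (i == k)%:R) *: G j.
  have := clifford_commutator i j k; rewrite mulmxA -/(P i j k) -/(P k i j).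
  move/(canRL (subrK _))/esym/(canRL (addKr _)) => ->.
  by rewrite opprB addrC addrA.
have P2 i j k : P j k i = P i j k + (2 * (i == j)%:R) *: G k - (2 * (i == k)%:R) *: G j.
  have := clifford_commutator j k i; rewrite mulmxA -/(P j k i) -/(P i j k).
  by move/(canRL (subrK _)) => ->; rewrite addrC addrA ![_ == i]eq_sym.
have S1 : \sum_i \sum_j \sum_k (2 * (j == k)%:R * T i j k) *: G i = 2 *: A.
  rewrite scaler_sumr; apply: eq_bigr => i _.
  rewrite scalerA mulr_sumr scaler_suml; apply: eq_bigr => j _.
  rewrite -(sum_delta (fun k => (2 * T i j k) *: G i)); apply: eq_bigr => k _.
  by rewrite scalerA eq_sym; congr (_ *: _); ring.
have S2 : \sum_i \sum_j \sum_k (2 * (i == k)%:R * T i j k) *: G j = - 2 *: A.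
  rewrite exchange_big scaler_sumr; apply: eq_bigr => j _ /=.
  rewrite scalerA mulr_sumr scaler_suml; apply: eq_bigr => i _.
  rewrite -(sum_delta (fun k => (- 2 * T j i k) *: G j) i); apply: eq_bigr => k _.
  by rewrite scalerA eq_sym (sk i j k); congr (_ *: _); ring.
have S3 : \sum_i \sum_j \sum_k (2 * (i == j)%:R * T i j k) *: G k = 0.
  apply: big1 => i _; apply: big1 => j _; apply: big1 => k _.
  by have [->|] := eqVneq i j; rewrite ?T0 !(mulr0, mul0r) scale0r.
have Z : Q + \sum_i \sum_j \sum_k T i j k *: P k i j
           + \sum_i \sum_j \sum_k T i j k *: P j k i = 0.
  rewrite -(sum3_rot (fun i j k => T i j k *: P k i j)).
  rewrite -(sum3_rot (fun i j k => T i j k *: P j k i)).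
  rewrite -(sum3_rot (fun i j k => T j k i *: P k i j)).
  rewrite -!big_split big1 // => i _; rewrite -!big_split big1 // => j _.
  by rewrite -!big_split big1 // => k _ /=; rewrite -!scalerDl cyc scale0r.
have Z1 : \sum_i \sum_j \sum_k T i j k *: P k i j = Q + 2 *: A - (- 2 *: A).
  rewrite -S1 -S2 -!big_split -sumrB; apply: eq_bigr => i _.
  rewrite -!big_split -sumrB; apply: eq_bigr => j _.
  rewrite -!big_split -sumrB; apply: eq_bigr => k _.
  rewrite P1 scalerBr scalerDr !scalerA.
  by congr (_ + _ *: _ - _ *: _); ring.
have Z2 : \sum_i \sum_j \sum_k T i j k *: P j k i = Q + 0 - (- 2 *: A).
  rewrite -[X in Q + X - _]S3 -S2 -!big_split -sumrB; apply: eq_bigr => i _.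
  rewrite -!big_split -sumrB; apply: eq_bigr => j _.
  rewrite -!big_split -sumrB; apply: eq_bigr => k _.
  rewrite P2 scalerBr scalerDr !scalerA.
  by congr (_ + _ *: _ - _ *: _); ring.
move: Z; rewrite Z1 Z2; clearbody Q A => Z.
have : 3 *: (Q + 2 *: A) = 0.
  rewrite -Z; apply/matrixP => p q; rewrite !mxE; ring.
move/eqP; rewrite scaler_eq0 pnatr_eq0 /= addr_eq0 => /eqP ->.
by rewrite scaleNr.
Qed.

Lemma symmetric_contraction (u : 'I_n -> 'I_n -> K) : (forall i j, u j i = u i j) ->
  \sum_i \sum_j u i j *: (G i *m G j) = (- \sum_i u i i)%:M.
Proof.
move=> sym; set S := LHS.
have S' : S = \sum_i \sum_j u i j *: (G j *m G i).
  rewrite /S exchange_big; apply: eq_bigr => i _; apply: eq_bigr => j _ /=.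
  by rewrite sym.
have : 2 *: S = 2 *: (- \sum_i u i i)%:M.
  rewrite scaler_nat mulr2n {2}S' -big_split scale_scalar_mx mulrN mulr_sumr -sumrN.
  rewrite raddf_sum; apply: eq_bigr => i _ /=; rewrite -big_split.
  rewrite -(sum_delta (fun j => (- (2 * u i j))%:M) i); apply: eq_bigr => j _ /=.
  rewrite -scalerDr (Gcl i j) addrC subrK -raddfN /= !scale_scalar_mx eq_sym.
  by congr (scalar_mx _); ring.
by move/(congr1 (fun X => 2^-1 *: X)); rewrite !scalerA mulVf ?pnatr_eq0 // !scale1r.
Qed.

(** The algebraic heart of Lichnerowicz's argument. The Bianchi identity
    contracts three of the four generators ([bianchi_contraction]); what is
    left is the Ricci tensor against [G_i G_l], and only its trace survives
    because it is symmetric ([symmetric_contraction]). *)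
Lemma curvature_contraction (T : 'I_n -> 'I_n -> 'I_n -> 'I_n -> K) :
  (forall i j k l, T j i k l = - T i j k l) ->
  (forall i j k l, T i j l k = - T i j k l) ->
  (forall i j k l, T i j k l + T j k i l + T k i j l = 0) ->
  \sum_(i < n) \sum_(j < n | (i < j)%N) G i *m G j *m bivector (T i j)
    = ((\sum_i \sum_j T i j j i) / 4)%:M.
Proof.
move=> sk1 sk2 cyc.
have pair i j k l : T i j k l = T k l i j.
  (* the octahedron argument: a signed sum of the four cyclic identities *)
  have e1 := cyc i j k l; have e2 := cyc j k l i.
  have e3 := cyc k l i j; have e4 := cyc l i j k.
  have h : 2 * (T i j k l - T k l i j) = 0.
    transitivity ((T i j k l + T j k i l + T k i j l) + (T j k l i + T k l j i + T l j k i)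
      - (T k l i j + T l i k j + T i k l j) - (T l i j k + T i j l k + T j l i k)).
      rewrite (sk2 i j k l) (sk2 j k i l) (sk2 k l i j) (sk2 l i j k).
      by rewrite (sk1 k i l j) (sk2 k i j l) (sk1 l j i k) (sk2 l j k i); ring.
    by rewrite e1 e2 e3 e4 !subr0 addr0.
  move/eqP: h; rewrite mulf_eq0 pnatr_eq0 /= subr_eq0 => /eqP; exact.
pose u i l := \sum_j T i j j l.
have usym i l : u l i = u i l.
  by apply: eq_bigr => j _; rewrite pair sk1 sk2 opprK.
have Q l := bianchi_contraction (T := fun i j k => T i j k l)
  (fun i j k => sk1 i j k l) (fun i j k => cyc i j k l).
have S : \sum_i \sum_j \sum_k \sum_l T i j k l *: (G i *m G j *m (G k *m G l))
    = (2 * \sum_i u i i)%:M.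
  transitivity (\sum_l (\sum_i \sum_j \sum_k T i j k l *: (G i *m G j *m G k)) *m G l).
    rewrite [RHS](eq_bigr (fun l => \sum_i \sum_j \sum_k
      T i j k l *: (G i *m G j *m (G k *m G l)))); last first.
      move=> l _; rewrite mulmx_suml; apply: eq_bigr => i _.
      rewrite mulmx_suml; apply: eq_bigr => j _.
      rewrite mulmx_suml; apply: eq_bigr => k _.
      by rewrite -scalemxAl !mulmxA.
    rewrite [RHS]exchange_big; apply: eq_bigr => i _ /=.
    rewrite [RHS]exchange_big; apply: eq_bigr => j _ /=.
    by rewrite [RHS]exchange_big.
  transitivity (- 2 *: \sum_i \sum_l u i l *: (G i *m G l)).
    rewrite exchange_big scaler_sumr; apply: eq_bigr => l _ /=.
    rewrite Q -scalemxAl mulmx_suml; congr (_ *: _); apply: eq_bigr => i _.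
    by rewrite -scalemxAl.
  by rewrite symmetric_contraction // scale_scalar_mx mulNr mulrN opprK.
have skB i j : bivector (T j i) = - bivector (T i j).
  rewrite -scaleN1r -[RHS]addr0.
  transitivity (-1 *: bivector (T i j) + bivector (fun _ _ => 0)).
    rewrite -bivector_comb; congr bivector; apply/funext => k; apply/funext => l.
    by rewrite sk1 mulN1r addr0.
  congr (_ + _); rewrite /bivector big1 ?scaler0 // => k _.
  by rewrite big1 // => l _; rewrite scale0r.
have H : 2 *: \sum_(i < n) \sum_(j < n | (i < j)%N) G i *m G j *m bivector (T i j)
    = 4^-1 *: (2 * \sum_i u i i)%:M.
  rewrite scaler_nat (sum_lt_half (F := fun i j => G i *m G j *m bivector (T i j))).
  - rewrite -S scaler_sumr; apply: eq_bigr => i _.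
    rewrite scaler_sumr; apply: eq_bigr => j _.
    rewrite bivectorE // -scalemxAr; congr (_ *: _).
    rewrite mulmx_sumr; apply: eq_bigr => k _.
    by rewrite mulmx_sumr; apply: eq_bigr => l _; rewrite -scalemxAr.
  - move=> i; have -> : bivector (T i i) = 0.
      have := skB i i; move/eqP; rewrite -addr_eq0 -mulr2n -scaler_nat scaler_eq0.
      by rewrite pnatr_eq0 => /eqP.
    by rewrite mulmx0.
  - move=> i j; have [->//|ij] := eqVneq i j.
    by rewrite skB Gcl (negPf ij) mulr0 raddf0 oppr0 sub0r mulmxN mulNmx opprK.
move/(congr1 (fun X => 2^-1 *: X)): H; rewrite !scalerA mulVf ?pnatr_eq0 // scale1r => ->.
by rewrite scale_scalar_mx; congr (_%:M); field.
Qed.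

End Clifford.

(** * The gamma matrices satisfy the Clifford relations *)

Section GammaMatrices.
Context (R : realType).
Local Notation C := R[i].

Lemma tensmxDl m n p q (A A' : 'M[C]_(m, n)) (B : 'M[C]_(p, q)) :
  tensmx (A + A') B = tensmx A B + tensmx A' B.
Proof. by apply/matrixP => i j; rewrite !mxE mulrDl. Qed.

Lemma tensmxDr m n p q (A : 'M[C]_(m, n)) (B B' : 'M[C]_(p, q)) :
  tensmx A (B + B') = tensmx A B + tensmx A B'.
Proof. by apply/matrixP => i j; rewrite !mxE mulrDr. Qed.

Lemma tensmx_scalar m n (a b : C) :
  tensmx (a%:M : 'M[C]_m) (b%:M : 'M[C]_n) = (a * b)%:M.
Proof.
apply/matrixP => i j; case: (mxtens_indexP i) => i0 i1; case: (mxtens_indexP j) => j0 j1.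
rewrite tensmxE !mxE (can_eq (@mxtens_indexK _ _)) -[RHS]mulr_natr xpair_eqE.
by case: (i0 == j0); case: (i1 == j1); rewrite ?mulr1n ?mulr0n ?mulr0 ?mul0r ?mulr1.
Qed.

Lemma mx2_mul (a b c d a' b' c' d' : C) :
  mx2 a b c d *m mx2 a' b' c' d'
    = mx2 (a * a' + b * c') (a * b' + b * d') (c * a' + d * c') (c * b' + d * d').
Proof.
apply/matrixP => i j; rewrite !mxE !big_ord_recl big_ord0 !mxE /= addr0.
by case: (i == ord0); case: (j == ord0).
Qed.

Lemma mx2_add (a b c d a' b' c' d' : C) :
  mx2 a b c d + mx2 a' b' c' d' = mx2 (a + a') (b + b') (c + c') (d + d').
Proof.
by apply/matrixP => i j; rewrite !mxE; case: (i == ord0); case: (j == ord0).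
Qed.

Lemma mx2_scalar (x : C) : x%:M = mx2 x 0 0 x.
Proof.
apply/matrixP => i j; rewrite !mxE.
by case: i => [[|[|i]] Hi]; case: j => [[|[|j]] Hj] //=.
Qed.

Let mx2E := (mx2_mul, mx2_add, mx2_scalar).

Lemma gamma_blocks :
  [/\ g1 R *m g1 R = (-1)%:M, g2 R *m g2 R = (-1)%:M, gt R *m gt R = 1%:M
    & [/\ g1 R *m g2 R + g2 R *m g1 R = 0, g1 R *m gt R + gt R *m g1 R = 0
      & g2 R *m gt R + gt R *m g2 R = 0]].
Proof.
have ii : 'i%C * 'i%C = -1 :> C by rewrite -expr2 sqr_i.
have z : 0 = mx2 0 0 0 0 :> 'M[C]_2.
  by apply/matrixP => i j; rewrite !mxE; case: (i == ord0); case: (j == ord0).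
rewrite z /g1 /g2 /gt !mx2E; split; [| | |split]; congr mx2;
  rewrite ?mulNr ?mulrN ?ii; ring.
Qed.

(** Each step of the recursion tensors the previous matrices with [gt], which
    squares to [1], hence keeps their relations, and anticommutes with the two
    new factors [g1] and [g2]. The bound [k.*2] includes the last generator of
    the odd-dimensional case. *)
Lemma gamma_rec_anticomm k i j : (i <= k.*2)%N -> (j <= k.*2)%N ->
  gamma_rec R k i *m gamma_rec R k j + gamma_rec R k j *m gamma_rec R k i
    = (- (2 * (i == j)%:R))%:M.
Proof.
have [e11 e22 ett [e12 e1t e2t]] := gamma_blocks.
have two m (A : 'M[C]_m) : A = (-1)%:M -> A + A = (-2)%:M.
  by move=> ->; rewrite -raddfD /=; congr (scalar_mx _); ring.
elim: k i j => [|k IH] i j.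
  rewrite !leqn0 => /eqP-> /eqP-> /=; rewrite mulr1; apply: two.
  by rewrite -scalar_mxM -expr2 sqr_i.
case: i => [|[|i]]; case: j => [|[|j]] //= ik jk;
  rewrite ?mulr1 ?mulr0 ?oppr0 ?raddf0 !tensmx_mul ?mul1mx ?mulmx1.
- by apply: two; rewrite e11 tensmx_scalar mul1r.
- by rewrite -tensmxDr e12 tensmx0.
- by rewrite -tensmxDr e1t tensmx0.
- by rewrite -tensmxDr addrC e12 tensmx0.
- by apply: two; rewrite e22 tensmx_scalar mul1r.
- by rewrite -tensmxDr e2t tensmx0.
- by rewrite -tensmxDr addrC e1t tensmx0.
- by rewrite -tensmxDr addrC e2t tensmx0.
- rewrite ett -tensmxDl IH; [|by move: ik; rewrite doubleS !ltnS|by move: jk; rewrite doubleS !ltnS].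
  by rewrite tensmx_scalar mulr1 !eqSS.
Qed.

Lemma gamma_clifford n (i j : 'I_n) :
  gamma R j *m gamma R i = - (2 * (i == j)%:R)%:M - gamma R i *m gamma R j.
Proof.
have le2 (l : 'I_n) : (l <= n./2.*2)%N.
  have := ltn_ord l; rewrite -[X in (_ < X)%N](odd_double_half n).
  by case: odd => [|/ltnW].
have := gamma_rec_anticomm (le2 i) (le2 j); rewrite raddfN /= => <-.
by rewrite [RHS]addrC addKr.
Qed.

End GammaMatrices.

(** * Complex matrix-valued functions *)

Section MatrixFunctions.
Context (R : realType) (n : nat) (M : oriented_manifold R n).
Local Notation C := R[i].
Implicit Types (U : set M) (f h : M -> C) (X Y : vector_field M).

Definition csmooth U f : Prop :=
  smooth_on U (fun x => complex.Re (f x)) /\ smooth_on U (fun x => complex.Im (f x)).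

Lemma ReD (a b : C) : complex.Re (a + b) = complex.Re a + complex.Re b.
Proof. by case: a b => [? ?] [? ?]. Qed.
Lemma ImD (a b : C) : complex.Im (a + b) = complex.Im a + complex.Im b.
Proof. by case: a b => [? ?] [? ?]. Qed.
Lemma ReM (a b : C) :
  complex.Re (a * b) = complex.Re a * complex.Re b - complex.Im a * complex.Im b.
Proof. by case: a b => [? ?] [? ?]. Qed.
Lemma ImM (a b : C) :
  complex.Im (a * b) = complex.Re a * complex.Im b + complex.Im a * complex.Re b.
Proof. by case: a b => [? ?] [? ?]. Qed.

Lemma csmooth_cst U (a : C) : csmooth U (fun=> a).
Proof. by split; exact: smooth_on_cst. Qed.

Lemma csmooth_real U (f : M -> R) : smooth_on U f -> csmooth U (fun x => (f x)%:C%C).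
Proof. by move=> sf; split=> //; exact: smooth_on_cst. Qed.

Lemma csmooth_add U f h : open U -> csmooth U f -> csmooth U h ->
  csmooth U (fun x => f x + h x).
Proof.
move=> oU [rf jf] [rh jh]; split.
  by apply: smooth_on_ext (smooth_on_add oU rf rh) => // x _; rewrite ReD.
by apply: smooth_on_ext (smooth_on_add oU jf jh) => // x _; rewrite ImD.
Qed.

Lemma csmooth_mul U f h : open U -> csmooth U f -> csmooth U h ->
  csmooth U (fun x => f x * h x).
Proof.
move=> oU [rf jf] [rh jh]; split.
  apply: smooth_on_ext (smooth_on_sub oU (smooth_on_mul oU rf rh) (smooth_on_mul oU jf jh)) => //.
  by move=> x _; rewrite ReM.
apply: smooth_on_ext (smooth_on_add oU (smooth_on_mul oU rf jh) (smooth_on_mul oU jf rh)) => //.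
by move=> x _; rewrite ImM.
Qed.

Lemma csmooth_ext U f h : open U -> (forall x, U x -> f x = h x) -> csmooth U f -> csmooth U h.
Proof.
by move=> oU e [rf jf]; split;
  [apply: smooth_on_ext rf => // x /e ->|apply: smooth_on_ext jf => // x /e ->].
Qed.

Lemma csmooth_sum U (I : Type) (s : seq I) (F : I -> M -> C) : open U ->
  (forall i, csmooth U (F i)) -> csmooth U (fun x => \sum_(i <- s) F i x).
Proof.
move=> oU sF; elim: s => [|i s IH].
  by apply: csmooth_ext (csmooth_cst U 0) => // x _; rewrite big_nil.
by apply: csmooth_ext (csmooth_add oU (sF i) IH) => // x _; rewrite big_cons.
Qed.

Lemma csmooth_dvC U X f : open U -> smooth_vector_field U X -> csmooth U f ->
  csmooth U (fun x => dvC x (X x) f).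
Proof. by move=> oU sX [rf jf]; split; apply: smooth_dv. Qed.

Lemma dvC_ext U f h p v : open U -> U p -> (forall q, U q -> f q = h q) ->
  dvC p v f = dvC p v h.
Proof.
by move=> oU Up e; rewrite /dvC; congr Complex; apply: (dv_ext v oU Up) => q /e ->.
Qed.

Lemma dvC_cst (p : M) v (a : C) : dvC p v (fun=> a : C) = 0 :> C.
Proof. by rewrite /dvC !dv_cst. Qed.

Lemma dvC_real (p : M) v (f : M -> R) : dvC p v (fun x => (f x)%:C%C) = (dv p v f)%:C%C.
Proof. by rewrite /dvC /= dv_cst. Qed.

Section At.
Context (U : set M) (p : M) (v : 'rV[R]_n).
Hypotheses (oU : open U) (Up : U p).

Let sd (F : M -> R) : smooth_on U F -> differentiable_at p F.
Proof. exact: smooth_differentiable_at. Qed.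

Lemma dvC_add f h : csmooth U f -> csmooth U h ->
  dvC p v (fun q => f q + h q) = dvC p v f + dvC p v h.
Proof.
move=> [/sd rf /sd jf] [/sd rh /sd jh].
rewrite /dvC; under [X in dv p v X]funext => q do rewrite ReD.
under [X in Complex _ (dv p v X)]funext => q do rewrite ImD.
by rewrite !dv_add.
Qed.

Lemma dvC_mul f h : csmooth U f -> csmooth U h ->
  dvC p v (fun q => f q * h q) = dvC p v f * h p + f p * dvC p v h.
Proof.
move=> [/sd rf /sd jf] [/sd rh /sd jh].
apply/eqP; rewrite eq_complex; apply/andP; split; apply/eqP.
  rewrite ReD !ReM /=; under [X in dv p v X]funext => q do rewrite ReM.
  rewrite dv_sub; [|exact: differentiable_at_mul|exact: differentiable_at_mul].
  by rewrite !dv_mul //; ring.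
rewrite ImD !ImM /=; under [X in dv p v X]funext => q do rewrite ImM.
rewrite dv_add; [|exact: differentiable_at_mul|exact: differentiable_at_mul].
by rewrite !dv_mul //; ring.
Qed.

Lemma dvC_sum (I : Type) (s : seq I) (F : I -> M -> C) :
  (forall i, csmooth U (F i)) ->
  dvC p v (fun q => \sum_(i <- s) F i q) = \sum_(i <- s) dvC p v (F i).
Proof.
move=> sF; elim: s => [|i s IH].
  by under [X in dvC p v X]funext => q do rewrite big_nil; rewrite big_nil dvC_cst.
under [X in dvC p v X]funext => q do rewrite big_cons.
by rewrite big_cons -IH dvC_add //; exact: csmooth_sum.
Qed.

Lemma dvC_linear f t w : csmooth U f ->
  dvC p (t *: v + w) f = t%:C%C * dvC p v f + dvC p w f.
Proof.
move=> [/sd rf /sd jf]; apply/eqP; rewrite eq_complex; apply/andP; split; apply/eqP.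
  by rewrite ReD ReM /= dv_linear // mul0r subr0.
by rewrite ImD ImM /= dv_linear // mul0r addr0.
Qed.

End At.

Lemma dvC_lie U X Y f p : open U -> smooth_vector_field U X ->
  smooth_vector_field U Y -> csmooth U f -> U p ->
  dvC p (lie X Y p) f
    = dvC p (X p) (fun q => dvC q (Y q) f) - dvC p (Y p) (fun q => dvC q (X q) f).
Proof.
move=> oU sX sY [rf jf] Up; rewrite {1}/dvC (dv_lie oU sX sY rf Up).
by rewrite (dv_lie oU sX sY jf Up).
Qed.

Definition smooth_mx U (p q : nat) (F : M -> 'M[C]_(p, q)) : Prop :=
  forall a b, csmooth U (fun x => F x a b).

Definition dvM (p q : nat) (x : M) (v : 'rV[R]_n) (F : M -> 'M[C]_(p, q)) :
  'M[C]_(p, q) := \matrix_(a, b) dvC x v (fun y => F y a b).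

Section Closure.
Context (U : set M) (p q : nat).
Hypothesis oU : open U.
Implicit Types F H : M -> 'M[C]_(p, q).

Lemma smooth_mx_ext F H : (forall x, U x -> F x = H x) ->
  smooth_mx U F -> smooth_mx U H.
Proof. by move=> e sF a b; apply: csmooth_ext (sF a b) => // x /e ->. Qed.

Lemma smooth_mx_cst (A : 'M[C]_(p, q)) : smooth_mx U (fun=> A).
Proof. by move=> a b; exact: csmooth_cst. Qed.

Lemma smooth_mx_add F H : smooth_mx U F -> smooth_mx U H ->
  smooth_mx U (fun x => F x + H x).
Proof.
by move=> sF sH a b; apply: csmooth_ext (csmooth_add oU (sF a b) (sH a b)) => // x _; rewrite mxE.
Qed.

Lemma smooth_mx_scale f F : csmooth U f -> smooth_mx U F ->
  smooth_mx U (fun x => f x *: F x).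
Proof.
by move=> sf sF a b; apply: csmooth_ext (csmooth_mul oU sf (sF a b)) => // x _; rewrite mxE.
Qed.

Lemma smooth_mx_sum (I : Type) (s : seq I) (P : pred I) (F : I -> M -> 'M[C]_(p, q)) :
  (forall i, smooth_mx U (F i)) -> smooth_mx U (fun x => \sum_(i <- s | P i) F i x).
Proof.
move=> sF; elim: s => [|i s IH].
  by apply: smooth_mx_ext (smooth_mx_cst 0) => x _; rewrite big_nil.
case Pi : (P i).
  by apply: smooth_mx_ext (smooth_mx_add (sF i) IH) => x _; rewrite big_cons Pi.
by apply: smooth_mx_ext IH => x _; rewrite big_cons Pi.
Qed.

Lemma smooth_mx_tr F : smooth_mx U F -> smooth_mx U (fun x => (F x)^T).
Proof. by move=> sF a b; apply: csmooth_ext (sF b a) => // x _; rewrite mxE. Qed.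

Lemma smooth_mx_mul m F (H : M -> 'M[C]_(q, m)) : smooth_mx U F -> smooth_mx U H ->
  smooth_mx U (fun x => F x *m H x).
Proof.
move=> sF sH a b.
apply: csmooth_ext (csmooth_sum (index_enum 'I_q) oU (fun k => csmooth_mul oU (sF a k) (sH k b))) => //.
by move=> x _; rewrite mxE.
Qed.

Lemma smooth_mx_dvM X F : smooth_vector_field U X -> smooth_mx U F ->
  smooth_mx U (fun x => dvM x (X x) F).
Proof.
by move=> sX sF a b; apply: csmooth_ext (csmooth_dvC oU sX (sF a b)) => // x _; rewrite mxE.
Qed.

Context (x : M) (v : 'rV[R]_n).
Hypothesis Ux : U x.

Lemma dvM_ext F H : (forall y, U y -> F y = H y) -> dvM x v F = dvM x v H.
Proof.
move=> e; apply/matrixP => a b; rewrite !mxE.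
by apply: (dvC_ext v oU Ux) => y /e ->.
Qed.

Lemma dvM_cst (A : 'M[C]_(p, q)) : dvM x v (fun=> A) = 0.
Proof. by apply/matrixP => a b; rewrite !mxE dvC_cst. Qed.

Lemma dvM_tr F : dvM x v (fun y => (F y)^T) = (dvM x v F)^T.
Proof.
by apply/matrixP => a b; rewrite !mxE; apply: (dvC_ext v oU Ux) => y _; rewrite mxE.
Qed.

Lemma dvM_add F H : smooth_mx U F -> smooth_mx U H ->
  dvM x v (fun y => F y + H y) = dvM x v F + dvM x v H.
Proof.
move=> sF sH; apply/matrixP => a b; rewrite !mxE -(dvC_add v Ux (sF a b) (sH a b)).
by apply: (dvC_ext v oU Ux) => y _; rewrite mxE.
Qed.

Lemma dvM_scale f F : csmooth U f -> smooth_mx U F ->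
  dvM x v (fun y => f y *: F y) = dvC x v f *: F x + f x *: dvM x v F.
Proof.
move=> sf sF; apply/matrixP => a b; rewrite !mxE -(dvC_mul v Ux sf (sF a b)).
by apply: (dvC_ext v oU Ux) => y _; rewrite mxE.
Qed.

Lemma dvM_sum_seq (I : Type) (s : seq I) (F : I -> M -> 'M[C]_(p, q)) :
  (forall i, smooth_mx U (F i)) ->
  dvM x v (fun y => \sum_(i <- s) F i y) = \sum_(i <- s) dvM x v (F i).
Proof.
move=> sF; apply/matrixP => a b; rewrite mxE summxE.
under [X in dvC x v X]funext => y do rewrite summxE.
rewrite (dvC_sum v oU Ux); last by move=> i; exact: sF.
by apply: eq_bigr => i _; rewrite mxE.
Qed.

Lemma dvM_sum (I : Type) (s : seq I) (P : pred I) (F : I -> M -> 'M[C]_(p, q)) :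
  (forall i, smooth_mx U (F i)) ->
  dvM x v (fun y => \sum_(i <- s | P i) F i y) = \sum_(i <- s | P i) dvM x v (F i).
Proof.
move=> sF; rewrite -[RHS]big_filter -dvM_sum_seq //.
by apply: dvM_ext => y _; rewrite big_filter.
Qed.

Lemma dvM_linear F t w : smooth_mx U F ->
  dvM x (t *: v + w) F = t%:C%C *: dvM x v F + dvM x w F.
Proof.
by move=> sF; apply/matrixP => a b; rewrite !mxE (dvC_linear v Ux t w (sF a b)).
Qed.

End Closure.

Lemma dvM_mul U x v p q m (F : M -> 'M[C]_(p, q)) (H : M -> 'M[C]_(q, m)) :
  open U -> U x -> smooth_mx U F -> smooth_mx U H ->
  dvM x v (fun y => F y *m H y) = dvM x v F *m H x + F x *m dvM x v H.
Proof.
move=> oU Ux sF sH; apply/matrixP => a b; rewrite !mxE.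
under [X in dvC x v X]funext => y do rewrite mxE.
rewrite (dvC_sum v oU Ux); last by move=> k; exact: csmooth_mul.
rewrite -big_split; apply: eq_bigr => k _ /=.
by rewrite (dvC_mul v Ux (sF a k) (sH k b)) !mxE.
Qed.

Lemma dvM_lie U X Y p q (F : M -> 'M[C]_(p, q)) x : open U ->
  smooth_vector_field U X -> smooth_vector_field U Y -> smooth_mx U F -> U x ->
  dvM x (lie X Y x) F
    = dvM x (X x) (fun y => dvM y (Y y) F) - dvM x (Y x) (fun y => dvM y (X y) F).
Proof.
move=> oU sX sY sF Ux; apply/matrixP => a b; rewrite !mxE (dvC_lie oU sX sY (sF a b) Ux).
by congr (_ - _); apply: (dvC_ext _ oU Ux) => y _; rewrite mxE.
Qed.

End MatrixFunctions.

(** * Curvature of the twisted connection *)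

(** The matrix identity behind [nab_commutator]: the terms with a first
    derivative of [f] and those mixing the left and right actions are symmetric
    in the two directions. *)
Lemma commutator_algebra (K : comPzRingType) (p q : nat) (f fX fY fXY fYX : 'M[K]_(p, q))
  (bX bY bL bXY bYX : 'M[K]_q) (tX tY tL tXY tYX : 'M[K]_p) :
  fXY + (fX *m bY^T + f *m bXY^T) + (tXY *m f + tY *m fX)
    + (fY *m bX^T + f *m (bX *m bY)^T + tY *m f *m bX^T)
    + (tX *m fY + tX *m (f *m bY^T) + tX *m tY *m f)
  - (fYX + (fY *m bX^T + f *m bYX^T) + (tYX *m f + tX *m fY)
    + (fX *m bY^T + f *m (bY *m bX)^T + tX *m f *m bY^T)
    + (tY *m fX + tY *m (f *m bX^T) + tY *m tX *m f))
  - (fXY - fYX + f *m bL^T + tL *m f)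
  = f *m (bXY - bYX - bL + (bX *m bY - bY *m bX))^T
    + (tXY - tYX - tL + (tX *m tY - tY *m tX)) *m f.
Proof.
have trB (a b : 'M[K]_q) : (a - b)^T = a^T - b^T by rewrite linearB.
have trD (a b : 'M[K]_q) : (a + b)^T = a^T + b^T by rewrite linearD.
rewrite trD !trB !mulmxDl !mulmxDr !mulNmx !mulmxN !mulmxA.
(* the products become atoms, after which the identity is additive *)
do ![move: (_ *m _) => ?].
by apply/matrixP => a b; rewrite !mxE; ring.
Qed.

Section CovariantDerivative.
Context (R : realType) (n : nat) (M : oriented_manifold R n).
Local Notation C := R[i].
Context (U : set M) (oU : open U).
Implicit Types (X Y : vector_field M).

Definition smooth_form (m : nat) (B : M -> 'rV[R]_n -> 'M[C]_m) : Prop :=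
  forall X, smooth_vector_field U X -> smooth_mx U (fun x => B x (X x)).

(** The curvature [dB(X, Y) + [B(X), B(Y)]] of [d + B], for [B] acting on columns. *)
Definition curv (m : nat) (B : M -> 'rV[R]_n -> 'M[C]_m) X Y x : 'M[C]_m :=
  dvM x (X x) (fun y => B y (Y y)) - dvM x (Y x) (fun y => B y (X y))
  - B x (lie X Y x) + (B x (X x) *m B x (Y x) - B x (Y x) *m B x (X x)).

Section Operator.
Context (p q : nat) (B : M -> 'rV[R]_n -> 'M[C]_q) (T : M -> 'rV[R]_n -> 'M[C]_p).
Hypotheses (sB : smooth_form B) (sT : smooth_form T).
Implicit Types F : M -> 'M[C]_(p, q).

(** The covariant derivative on a tensor product [V (x) W] viewed as a space of
    matrices, with [T] acting on [V] and [B] on [W]. *)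
Definition nab F x v : 'M[C]_(p, q) := dvM x v F + F x *m (B x v)^T + T x v *m F x.

Lemma smooth_nab X F : smooth_vector_field U X -> smooth_mx U F ->
  smooth_mx U (fun x => nab F x (X x)).
Proof.
move=> sX sF; apply: smooth_mx_add => //.
  apply: smooth_mx_add => //; first exact: smooth_mx_dvM.
  by apply: smooth_mx_mul => //; apply: smooth_mx_tr => //; exact: sB.
by apply: smooth_mx_mul => //; exact: sT.
Qed.

Lemma nab_ext F H x v : U x -> (forall y, U y -> F y = H y) -> nab F x v = nab H x v.
Proof. by move=> Ux e; rewrite /nab (dvM_ext oU v Ux e) e. Qed.

Lemma nab_sum (I : Type) (s : seq I) (F : I -> M -> 'M[C]_(p, q)) x v : U x ->
  (forall i, smooth_mx U (F i)) ->
  nab (fun y => \sum_(i <- s) F i y) x v = \sum_(i <- s) nab (F i) x v.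
Proof.
move=> Ux sF; rewrite /nab (dvM_sum oU v Ux) // mulmx_suml mulmx_sumr.
by rewrite -!big_split.
Qed.

(** The two factors of a tensor product contribute their curvatures separately. *)
Lemma nab_commutator X Y F x : U x -> smooth_vector_field U X ->
  smooth_vector_field U Y -> smooth_mx U F ->
  nab (fun y => nab F y (Y y)) x (X x) - nab (fun y => nab F y (X y)) x (Y x)
    - nab F x (lie X Y x)
  = F x *m (curv B X Y x)^T + curv T X Y x *m F x.
Proof.
move=> Ux sX sY sF.
have second (Z W : vector_field M) : smooth_vector_field U Z -> smooth_vector_field U W ->
    nab (fun y => nab F y (W y)) x (Z x)
    = dvM x (Z x) (fun y => dvM y (W y) F)
    + (dvM x (Z x) F *m (B x (W x))^T + F x *m (dvM x (Z x) (fun y => B y (W y)))^T)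
    + (dvM x (Z x) (fun y => T y (W y)) *m F x + T x (W x) *m dvM x (Z x) F)
    + (dvM x (W x) F *m (B x (Z x))^T + F x *m (B x (Z x) *m B x (W x))^T
       + T x (W x) *m F x *m (B x (Z x))^T)
    + (T x (Z x) *m dvM x (W x) F + T x (Z x) *m (F x *m (B x (W x))^T)
       + T x (Z x) *m T x (W x) *m F x).
  move=> sZ sW; rewrite {1}/nab.
  have s1 := smooth_mx_dvM oU sW sF.
  have s2 := smooth_mx_mul oU sF (smooth_mx_tr oU (sB sW)).
  have s3 := smooth_mx_mul oU (sT sW) sF.
  rewrite (dvM_add oU (Z x) Ux (smooth_mx_add oU s1 s2) s3) (dvM_add oU (Z x) Ux s1 s2).
  rewrite (dvM_mul (Z x) oU Ux sF (smooth_mx_tr oU (sB sW))) (dvM_tr oU (Z x) Ux).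
  rewrite (dvM_mul (Z x) oU Ux (sT sW) sF).
  by rewrite /nab !mulmxDl !mulmxDr trmx_mul !mulmxA.
apply: etrans (f_equal2 (fun a b => a - b - _) (second X Y sX sY) (second Y X sY sX)) _.
rewrite /nab (dvM_lie oU sX sY sF Ux); exact: commutator_algebra.
Qed.

End Operator.

Section BivectorForm.
Context (m d : nat) (G : 'I_m -> 'M[C]_d) (w : M -> 'rV[R]_n -> 'M[R]_m).
Hypothesis Gcl : forall i j, G j *m G i = - (2 * (i == j)%:R)%:M - G i *m G j.
Hypothesis w_skew : forall x v, U x -> (w x v)^T = - w x v.
Hypothesis w_smooth : forall X, smooth_vector_field U X ->
  forall i j, smooth_on U (fun x => w x (X x) i j).

Definition cbivector (a : 'M[R]_m) : 'M[C]_d := bivector G (fun i j => (a i j)%:C%C).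

Lemma smooth_cbivector : smooth_form (fun x v => cbivector (w x v)).
Proof.
move=> X sX; apply: smooth_mx_scale => //; first exact: csmooth_cst.
apply: smooth_mx_sum => // i; apply: smooth_mx_sum => // j.
apply: smooth_mx_scale => //; last exact: smooth_mx_cst.
by apply: csmooth_real; exact: w_smooth.
Qed.

Lemma dvM_cbivector X x v : U x -> smooth_vector_field U X ->
  dvM x v (fun y => cbivector (w y (X y)))
    = cbivector (\matrix_(i, j) dv x v (fun y => w y (X y) i j)).
Proof.
move=> Ux sX; rewrite /cbivector /bivector.
have s1 i j : csmooth U (fun y => (w y (X y) i j)%:C%C).
  by apply: csmooth_real; exact: w_smooth.
have s2 i j : smooth_mx U (fun y => (w y (X y) i j)%:C%C *: (G i *m G j)).
  by apply: smooth_mx_scale => //; exact: smooth_mx_cst.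
rewrite (dvM_scale oU v Ux); first last.
- by apply: smooth_mx_sum => // i; apply: smooth_mx_sum.
- exact: csmooth_cst.
rewrite dvC_cst scale0r add0r; congr (_ *: _).
rewrite (dvM_sum oU v Ux); last by move=> i; apply: smooth_mx_sum.
apply: eq_bigr => i _; rewrite (dvM_sum oU v Ux) //.
apply: eq_bigr => j _; rewrite (dvM_scale oU v Ux) //; last exact: smooth_mx_cst.
by rewrite dvM_cst scaler0 addr0 dvC_real mxE.
Qed.

Lemma cbivector_comb t a b : cbivector (t *: a + b) = t%:C%C *: cbivector a + cbivector b.
Proof.
rewrite /cbivector -bivector_comb; congr bivector.
by apply/funext => i; apply/funext => j; rewrite !mxE rmorphD rmorphM.
Qed.

Lemma cbivectorD a b : cbivector (a + b) = cbivector a + cbivector b.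
Proof. by rewrite -{1}(scale1r a) cbivector_comb scale1r. Qed.

Lemma cbivectorN a : cbivector (- a) = - cbivector a.
Proof.
have c0 : cbivector 0 = 0 by apply: (addrI (cbivector 0)); rewrite -cbivectorD !addr0.
by rewrite -scaleN1r -[-1 *: a]addr0 cbivector_comb c0 addr0 rmorphN1 scaleN1r.
Qed.

Lemma cbivector_bracket a b : a^T = - a -> b^T = - b ->
  cbivector a *m cbivector b - cbivector b *m cbivector a = cbivector (b *m a - a *m b).
Proof.
have sk (c : 'M[R]_m) : c^T = - c -> forall i j, (c j i)%:C%C = - (c i j)%:C%C :> C.
  move=> sc i j; rewrite -rmorphN; congr (_%:C%C).
  by have := congr1 (fun A : 'M[R]_m => A i j) sc; rewrite !mxE.
move=> /sk ska /sk skb; rewrite (bivector_bracket Gcl ska skb).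
congr bivector; apply/funext => i; apply/funext => j.
rewrite !mxE rmorphB /= !rmorph_sum -sumrB; apply: eq_bigr => l _.
by rewrite !rmorphM.
Qed.

(** The bivector map commutes with [d] by linearity and with brackets by
    [bivector_bracket]; the reversal of products there matches that in
    [form_curv]. *)
Lemma curv_cbivector X Y x : U x -> smooth_vector_field U X ->
  smooth_vector_field U Y ->
  curv (fun x v => cbivector (w x v)) X Y x = cbivector (form_curv w X Y x).
Proof.
move=> Ux sX sY; rewrite /curv !dvM_cbivector // cbivector_bracket; [|exact: w_skew..].
have cB a b : cbivector (a - b) = cbivector a - cbivector b.
  by rewrite cbivectorD cbivectorN.
rewrite /form_curv; apply: etrans (esym (cbivectorD _ _)).
apply: (f_equal2 +%R _ (erefl _)); apply: etrans (esym (cB _ _)).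
apply: (f_equal2 (fun a b => a - b) _ (erefl _)); apply: etrans (esym (cB _ _)) _.
by congr cbivector; apply/matrixP => i j; rewrite !mxE.
Qed.

End BivectorForm.
End CovariantDerivative.

(** * Clifford multiplication on twisted spinors *)

Section TwistedSpinors.
Context (R : realType) (n r : nat).
Local Notation C := R[i].
Local Notation V := (twisted R n r).
Implicit Types (psi : V).

Lemma cl_cl (i j : 'I_n) psi : cl i (cl j psi) = psi *m (gamma R i *m gamma R j)^T.
Proof. by rewrite /cl trmx_mul mulmxA. Qed.

Lemma clD (i : 'I_n) psi psi' : cl i (psi + psi') = cl i psi + cl i psi'.
Proof. exact: mulmxDl. Qed.

Lemma clZ (i : 'I_n) (c : C) psi : cl i (c *: psi) = c *: cl i psi.
Proof. by rewrite /cl -scalemxAl. Qed.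

Lemma cl_sum (I : Type) (s : seq I) (P : pred I) (F : I -> V) (i : 'I_n) :
  cl i (\sum_(k <- s | P k) F k) = \sum_(k <- s | P k) cl i (F k).
Proof. exact: mulmx_suml. Qed.

Lemma cl_sq (i : 'I_n) psi : cl i (cl i psi) = - psi.
Proof.
have : gamma R i *m gamma R i = (-1)%:M.
  apply: (@scalerI _ _ 2); first by rewrite pnatr_eq0.
  rewrite scaler_nat mulr2n {1}gamma_clifford eqxx mulr1 subrK.
  by rewrite scale_scalar_mx -raddfN mulrN1.
by rewrite cl_cl => ->; rewrite tr_scalar_mx mul_mx_scalar scaleN1r.
Qed.

Lemma cl_anticomm (i j : 'I_n) psi : i != j -> cl j (cl i psi) = - cl i (cl j psi).
Proof.
move=> ij; rewrite !cl_cl gamma_clifford (negPf ij) mulr0 raddf0 oppr0 sub0r.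
by rewrite raddfN mulmxN.
Qed.

(** From [e_i e_i = -1] and [e_j e_i = - e_i e_j]. *)
Lemma cl_double_sum (F : 'I_n -> 'I_n -> V) :
  \sum_i \sum_j cl i (cl j (F i j))
    = - \sum_i F i i + \sum_(i < n) \sum_(j < n | (i < j)%N) cl i (cl j (F i j - F j i)).
Proof.
rewrite sum_lt_split -sumrN; congr (_ + _).
  by apply: eq_bigr => i _; rewrite cl_sq.
apply: eq_bigr => i _; apply: eq_bigr => j ij.
rewrite (@cl_anticomm i j); last by apply: contraTneq ij => ->; rewrite ltnn.
by rewrite /cl !mulmxBl.
Qed.

Lemma cl_cbivector (psi : V) (a : 'M[R]_n) :
  psi *m (cbivector (@gamma R n) a)^T
    = 2^-1 *: \sum_(i < n) \sum_(j < n | (i < j)%N) (a i j)%:C%C *: cl i (cl j psi).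
Proof.
rewrite /cbivector /bivector linearZ /= -scalemxAr; congr (_ *: _).
rewrite linear_sum mulmx_sumr; apply: eq_bigr => i _.
rewrite linear_sum mulmx_sumr; apply: eq_bigr => j _.
by rewrite linearZ -scalemxAr cl_cl.
Qed.

Lemma kappaF_cbivector (psi : V) (a : 'M[R]_r) :
  cbivector (@gamma R r) a *m psi
    = 2^-1 *: \sum_(k < r) \sum_(l < r | (k < l)%N) (a k l)%:C%C *: kappaF k l psi.
Proof.
rewrite /cbivector /bivector -scalemxAl; congr (_ *: _).
rewrite mulmx_suml; apply: eq_bigr => k _.
rewrite mulmx_suml; apply: eq_bigr => l _.
by rewrite -scalemxAl.
Qed.

End TwistedSpinors.

(** * The Schroedinger-Lichnerowicz formula *)

Section Lichnerowicz.
Context (R : realType) (n r : nat) (M : oriented_manifold R n).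
Context (g : riemannian_metric M) (lc : levi_civita g) (S : spincr_structure r g).
Context (th : SO_connection (PSO S)) (A : U1_connection (PU S)).
Context (phi : Pspin S -> twisted R n r) (hphi : twisted_spinor phi).
Context (U : set M) (s : M -> Pspin S) (hs : smooth_section U s).
Local Notation C := R[i].
Local Notation e := (eframe s).

Let oU : open U. Proof. by case: hs. Qed.

Lemma smooth_eframe i : smooth_vector_field U (e i).
Proof. exact: tframe_smooth. Qed.

Lemma eframe_frame x : U x -> oriented_orthonormal g x (tframe (s x)).
Proof. by case: hs => _ ps _ Ux; have := tframe_frame (s x); rewrite ps. Qed.

Lemma eframe_ortho x : U x -> forall i j, g x (e i x) (e j x) = (i == j)%:R.
Proof. by move=> /eframe_frame[+ _]; apply. Qed.

Lemma eframe_span x : U x -> forall v, v = \sum_j g x v (e j x) *: e j x.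
Proof.
move=> Ux v; have [ort det] := eframe_frame Ux.
have uE : tframe (s x) \in unitmx by rewrite unitmxE unitfE gt_eqF.
have Ev : v = \sum_j (v *m invmx (tframe (s x))) ord0 j *: e j x.
  by rewrite -[LHS](mulmxKV uE) mulmx_sum_row.
rewrite {1}Ev; apply: eq_bigr => j _; congr (_ *: _).
rewrite [in RHS]Ev metric_suml (bigD1 j) //= metricZl eframe_ortho // eqxx mulr1.
rewrite big1 ?addr0 // => k kj.
by rewrite metricZl eframe_ortho // (negPf kj) mulr0.
Qed.

Definition tangent_form := conn_form lc e.

Definition spin_form (x : M) (v : 'rV[R]_n) : 'M[C]_(sdim n./2) :=
  cbivector (@gamma R n) (tangent_form x v).

Definition twist_form (x : M) (v : 'rV[R]_n) : 'M[C]_(sdim r./2) :=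
  cbivector (@gamma R r) (th (fSO s) x v) + ('i%C / 2 * (A (fU s) x v)%:C%C)%:M.

Local Notation D := (nab spin_form twist_form).

Lemma nablaS_nab (Psi : local_field S) x v :
  nablaS lc th A Psi s x v = D (Psi s) x v.
Proof.
have spinE : Psi s x *m (spin_form x v)^T
    = 2^-1 *: (\sum_(i < n) \sum_(j < n | (i < j)%N)
        (omega lc s i j x v)%:C%C *: cl i (cl j (Psi s x))).
  rewrite cl_cbivector; congr (_ *: _).
  by apply: eq_bigr => i _; apply: eq_bigr => j _; rewrite mxE.
have twistE : twist_form x v *m Psi s x
    = 2^-1 *: (\sum_(k < r) \sum_(l < r | (k < l)%N)
        (th (fSO s) x v k l)%:C%C *: kappaF k l (Psi s x))
      + ('i%C / 2 * (A (fU s) x v)%:C%C) *: Psi s x.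
  by rewrite mulmxDl kappaF_cbivector mul_scalar_mx.
by rewrite /nab spinE twistE [RHS]addrA.
Qed.

Lemma DiracE (Psi : local_field S) :
  Dirac lc th A Psi s = fun x => \sum_i cl i (D (Psi s) x (e i x)).
Proof.
by apply/funext => x; apply: eq_bigr => i _; rewrite /nablaE nablaS_nab.
Qed.

Lemma smooth_tangent_form (X : vector_field M) : smooth_vector_field U X ->
  forall i j, smooth_on U (fun x => tangent_form x (X x) i j).
Proof. by move=> sX i j; exact: (smooth_conn_form lc oU smooth_eframe i j sX). Qed.

Lemma tangent_form_skew x v : U x -> (tangent_form x v)^T = - tangent_form x v.
Proof. exact: (conn_form_skew lc oU smooth_eframe eframe_ortho). Qed.

Let sSO : smooth_section U (fSO s). Proof. exact: toSO_smooth. Qed.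
Let sUu : smooth_section U (fU s). Proof. exact: toU_smooth. Qed.

Lemma smooth_theta (X : vector_field M) : smooth_vector_field U X ->
  forall k l, smooth_on U (fun x => th (fSO s) x (X x) k l).
Proof.
move=> sX k l; have [_ H] := theta_smooth th sSO k l.
exact: H.
Qed.

Lemma smooth_connA (X : vector_field M) : smooth_vector_field U X ->
  smooth_on U (fun x => A (fU s) x (X x)).
Proof. by move=> sX; have [_ H] := connA_smooth A sUu; exact: H. Qed.

Lemma smooth_spin_form : smooth_form U spin_form.
Proof. exact: (smooth_cbivector oU _ smooth_tangent_form). Qed.

Lemma smooth_U1_part (X : vector_field M) : smooth_vector_field U X ->
  csmooth U (fun x => 'i%C / 2 * (A (fU s) x (X x))%:C%C).
Proof.
move=> sX; apply: csmooth_mul => //; first exact: csmooth_cst.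
by apply: csmooth_real; exact: smooth_connA.
Qed.

Lemma scalar_mx_fun (m : nat) (c : M -> C) :
  (fun x => (c x)%:M : 'M[C]_m) = (fun x => c x *: 1%:M).
Proof. by apply/funext => x; rewrite scale_scalar_mx mulr1. Qed.

Lemma smooth_scalar_mx (m : nat) (c : M -> C) : csmooth U c ->
  smooth_mx U (fun x => (c x)%:M : 'M[C]_m).
Proof.
by move=> sc; rewrite scalar_mx_fun; apply: smooth_mx_scale => //; exact: smooth_mx_cst.
Qed.

Lemma smooth_twist_form : smooth_form U twist_form.
Proof.
move=> X sX; apply: smooth_mx_add => //.
  exact: (smooth_cbivector oU _ smooth_theta sX).
exact: smooth_scalar_mx (smooth_U1_part sX).
Qed.

Lemma curv_twist_form X Y x : U x -> smooth_vector_field U X -> smooth_vector_field U Y ->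
  curv twist_form X Y x
    = cbivector (@gamma R r) (form_curv (th (fSO s)) X Y x)
      + ('i%C / 2 * (ext_d (A (fU s)) X Y x)%:C%C)%:M.
Proof.
move=> Ux sX sY.
have skew z v : U z -> (th (fSO s) z v)^T = - th (fSO s) z v.
  by move=> Uz; exact: (theta_skew th sSO v Uz).
rewrite -(curv_cbivector oU (@gamma_clifford R r) skew smooth_theta Ux sX sY) /curv.
have dT v (Z : vector_field M) : smooth_vector_field U Z ->
    dvM x v (fun y => twist_form y (Z y))
    = dvM x v (fun y => cbivector (@gamma R r) (th (fSO s) y (Z y)))
      + ('i%C / 2 * (dv x v (fun y => A (fU s) y (Z y)))%:C%C)%:M.
  move=> sZ; rewrite (dvM_add oU v Ux); first last.
  - exact: smooth_scalar_mx (smooth_U1_part sZ).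
  - exact: (smooth_cbivector oU _ smooth_theta sZ).
  congr (_ + _); rewrite scalar_mx_fun (dvM_scale oU v Ux (smooth_U1_part sZ)); last exact: smooth_mx_cst.
  rewrite dvM_cst scaler0 addr0 (dvC_mul v Ux (csmooth_cst U _)); last first.
    by apply: csmooth_real; exact: smooth_connA.
  by rewrite dvC_cst mul0r add0r dvC_real scale_scalar_mx mulr1.
rewrite !dT // /twist_form /ext_d !rmorphB /=.
move: (dvM _ _ _) (dvM _ _ _) (cbivector _ _) (cbivector _ _) (cbivector _ _) => a b c d f.
rewrite !(mulmxDl, mulmxDr) !mul_scalar_mx !mul_mx_scalar !scale_scalar_mx.
move: (_ *m _) (_ *m _) => k l.
by apply/matrixP => i j; rewrite !mxE; ring.
Qed.

Lemma exchange_big_pairs (V : nmodType) (I J : finType) (P : rel I) (Q : rel J)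
  (H : I -> I -> J -> J -> V) :
  \sum_i \sum_(j | P i j) \sum_k \sum_(l | Q k l) H i j k l
    = \sum_k \sum_(l | Q k l) \sum_i \sum_(j | P i j) H i j k l.
Proof.
rewrite pair_big_dep /=.
under eq_bigr do rewrite pair_big_dep /=.
rewrite exchange_big /= [RHS]pair_big_dep /=.
by apply: eq_bigr => kl _; rewrite [RHS]pair_big_dep.
Qed.

Lemma expr_smooth : smooth_mx U (expr phi s).
Proof. by case: hphi => _ _ H a b; exact: H. Qed.

Lemma nab_linear_algebra (p q : nat) (f d d' : 'M[C]_(p, q)) (b b' : 'M[C]_q)
  (c c' : 'M[C]_p) (t : C) :
  (t *: d + d') + f *m (t *: b + b')^T + (t *: c + c') *m f
    = t *: (d + f *m b^T + c *m f) + (d' + f *m b'^T + c' *m f).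
Proof.
have -> : (t *: b + b')^T = t *: b^T + b'^T by apply/matrixP => i j; rewrite !mxE.
rewrite mulmxDl mulmxDr -scalemxAr -scalemxAl.
do ![move: (_ *m _) => ?].
by apply/matrixP => i j; rewrite !mxE; ring.
Qed.

(** Used to expand the derivative along the bracket [[e_i, e_j]]. *)
Lemma nab_linear_frame F x v : U x -> smooth_mx U F ->
  D F x v = \sum_k (g x v (e k x))%:C%C *: D F x (e k x).
Proof.
move=> Ux sF.
have lin t u w : D F x (t *: u + w) = t%:C%C *: D F x u + D F x w.
  have thlin : (forall k l, th (fSO s) x (t *: u + w) k l
      = t * th (fSO s) x u k l + th (fSO s) x w k l).
    by move=> k l; have [H _] := theta_smooth th sSO k l; exact: H.
  have Alin : A (fU s) x (t *: u + w) = t * A (fU s) x u + A (fU s) x w.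
    by have [H _] := connA_smooth A sUu; exact: H.
  have thm : th (fSO s) x (t *: u + w) = t *: th (fSO s) x u + th (fSO s) x w.
    by apply/matrixP => k l; rewrite thlin !mxE.
  have Bl : spin_form x (t *: u + w) = t%:C%C *: spin_form x u + spin_form x w.
    rewrite /spin_form /tangent_form.
    by rewrite (conn_form_linear lc oU smooth_eframe t u w Ux) cbivector_comb.
  have Tl : twist_form x (t *: u + w) = t%:C%C *: twist_form x u + twist_form x w.
    rewrite /twist_form.
    have -> : (A (fU s) x (t *: u + w))%:C%C
        = t%:C%C * (A (fU s) x u)%:C%C + (A (fU s) x w)%:C%C.
      by rewrite Alin rmorphD rmorphM.
    rewrite thm cbivector_comb.
    move: (cbivector _ _) (cbivector _ _) => ? ?.
    by apply/matrixP => i j; rewrite !mxE; ring.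
  rewrite /nab (dvM_linear u Ux t w sF) Bl Tl.
  exact: nab_linear_algebra.
have D0 : D F x 0 = 0.
  have := lin 1 0 0; rewrite scale1r addr0 scale1r.
  by move=> /esym/(canRL (addrK _)); rewrite subrr.
rewrite {1}(eframe_span Ux v).
elim: (index_enum 'I_n) => [|k t IH]; first by rewrite !big_nil D0.
by rewrite !big_cons lin IH.
Qed.

(** [bivector_generator], transported to the right action on spinors. *)
Lemma spin_form_generator x v j (psi : twisted R n r) : U x ->
  cl j psi *m (spin_form x v)^T
    = cl j (psi *m (spin_form x v)^T)
      + \sum_k (tangent_form x v j k)%:C%C *: cl k psi.
Proof.
move=> Ux; rewrite /cl -!mulmxA -!trmx_mul.
have sk i k : ((tangent_form x v) k i)%:C%C = - ((tangent_form x v) i k)%:C%C :> C.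
  rewrite -rmorphN; congr (_%:C%C).
  by have := congr1 (fun N : 'M[R]_n => N i k) (tangent_form_skew v Ux); rewrite !mxE.
have := bivector_generator (@gamma_clifford R n) j sk.
move/(canRL (subrK _)); rewrite -/(cbivector _ _) -/(spin_form x v) => ->.
rewrite linearD mulmxDr addrC linear_sum mulmx_sumr; congr (_ + _).
by apply: eq_bigr => k _; rewrite linearZ -scalemxAr.
Qed.

(** The Leibniz rule for Clifford multiplication by [e_j]: the sum is the
    multiplication by [nabla e_j]. *)
Lemma nab_cl (F : M -> twisted R n r) x v j : U x -> smooth_mx U F ->
  D (fun y => cl j (F y)) x v
    = cl j (D F x v) + \sum_k (tangent_form x v j k)%:C%C *: cl k (F x).
Proof.
move=> Ux sF; rewrite /nab spin_form_generator //.
rewrite (dvM_mul v oU Ux sF (smooth_mx_cst U _)) dvM_cst mulmx0 addr0.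
rewrite !clD /cl [in LHS]mulmxA.
rewrite -!addrA; congr (_ + (_ + _)); exact: addrC.
Qed.

Lemma tangent_curv_bianchi x : U x -> forall i j k l,
  form_curv tangent_form (e i) (e j) x k l + form_curv tangent_form (e j) (e k) x i l
    + form_curv tangent_form (e k) (e i) x j l = 0.
Proof.
move=> Ux i j k l; have sE := smooth_eframe.
have H a b c : form_curv tangent_form (e a) (e b) x c l
    = g x (riem lc (e a) (e b) (e c) x) (e l x).
  by rewrite (riem_form_curv lc oU sE eframe_ortho eframe_span).
rewrite !H -!metricDl (riem_bianchi lc oU Ux) //; exact: metric0l.
Qed.

(** The spin part of the curvature acts by the bivector of the Riemann tensor. *)
Lemma Ricci_contraction x (psi : twisted R n r) : U x ->
  \sum_(i < n) \sum_(j < n | (i < j)%N)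
    cl i (cl j (psi *m (curv spin_form (e i) (e j) x)^T))
  = (scal lc s x / 4)%:C%C *: psi.
Proof.
move=> Ux; have sE := smooth_eframe.
pose T i j k l : C := (form_curv tangent_form (e i) (e j) x k l)%:C%C.
have TE i j k l : T i j k l = (g x (riem lc (e i) (e j) (e k) x) (e l x))%:C%C.
  by rewrite (riem_form_curv lc oU sE eframe_ortho eframe_span).
have sk1 i j k l : T j i k l = - T i j k l.
  by rewrite !TE (riem_antisym lc _ _ oU Ux) // metricNl rmorphN.
have sk2 i j k l : T i j l k = - T i j k l.
  have := form_curv_skew oU Ux tangent_form_skew
    (smooth_tangent_form (sE i)) (smooth_tangent_form (sE j)).
  move/(congr1 (fun N : 'M[R]_n => N k l)); rewrite mxE [in RHS]mxE /T => ->.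
  by rewrite rmorphN.
have cyc i j k l : T i j k l + T j k i l + T k i j l = 0.
  by rewrite /T -!rmorphD tangent_curv_bianchi.
have K := curvature_contraction (@gamma_clifford R n) sk1 sk2 cyc.
transitivity (psi *m (\sum_(i < n) \sum_(j < n | (i < j)%N)
    gamma R i *m gamma R j *m bivector (@gamma R n) (T i j))^T).
  rewrite linear_sum mulmx_sumr; apply: eq_bigr => i _.
  rewrite linear_sum mulmx_sumr; apply: eq_bigr => j _.
  rewrite (curv_cbivector oU (@gamma_clifford R n) tangent_form_skew
    smooth_tangent_form Ux (sE i) (sE j)).
  by rewrite cl_cl -mulmxA -trmx_mul.
rewrite K tr_scalar_mx mul_mx_scalar; congr (_ *: _).
rewrite rmorphM fmorphV rmorph_nat; congr (_ / _).
rewrite /scal rmorph_sum; apply: eq_bigr => i _.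
by rewrite rmorph_sum; apply: eq_bigr => j _; rewrite TE.
Qed.

Lemma twist_contraction x (psi : twisted R n r) : U x ->
  \sum_(i < n) \sum_(j < n | (i < j)%N)
    cl i (cl j (curv twist_form (e i) (e j) x *m psi))
  = 2^-1 *: (\sum_(k < r) \sum_(l < r | (k < l)%N)
      cl2 (fun i j => Theta th (fSO s) k l (e i) (e j) x) (kappaF k l psi))
    + ('i%C / 2) *: cl2 (fun i j => ext_d (A (fU s)) (e i) (e j) x) psi.
Proof.
move=> Ux; have sE := smooth_eframe.
transitivity (\sum_(i < n) \sum_(j < n | (i < j)%N)
   (2^-1 *: \sum_(k < r) \sum_(l < r | (k < l)%N)
      (Theta th (fSO s) k l (e i) (e j) x)%:C%C *: cl i (cl j (kappaF k l psi))
    + ('i%C / 2) *: ((ext_d (A (fU s)) (e i) (e j) x)%:C%C *: cl i (cl j psi)))).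
  apply: eq_bigr => i _; apply: eq_bigr => j _.
  rewrite (curv_twist_form Ux (sE i) (sE j)) mulmxDl !clD mul_scalar_mx !clZ scalerA.
  congr (_ + _); rewrite kappaF_cbivector !clZ; congr (_ *: _).
  rewrite !cl_sum; apply: eq_bigr => k _; rewrite !cl_sum; apply: eq_bigr => l _.
  by rewrite !clZ Theta_form_curv.
under eq_bigr do rewrite big_split /=.
rewrite big_split /=; congr (_ + _).
  under eq_bigr do rewrite -scaler_sumr.
  rewrite -scaler_sumr; congr (_ *: _).
  exact: exchange_big_pairs.
under eq_bigr do rewrite -scaler_sumr.
by rewrite -scaler_sumr.
Qed.

Lemma lichnerowicz x : U x ->
  Dirac lc th A (Dirac lc th A (expr phi)) s x
    = laplacian lc th A (expr phi) s x
      + (scal lc s x / 4)%:C%C *: expr phi s x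
      + 2^-1 *: cl_Theta th (expr phi) s x
      + ('i%C / 2) *: cl_dA A (expr phi) s x.
Proof.
move=> Ux; have sE := smooth_eframe; set F := expr phi s.
have sF : smooth_mx U F := expr_smooth.
pose chi j : M -> twisted R n r := fun y => D F y (e j y).
have schi j : smooth_mx U (chi j) := smooth_nab oU smooth_spin_form smooth_twist_form (sE j) sF.
pose N i j := D (chi j) x (e i x).
(* [H i j] is the second covariant derivative along [e_i], [e_j]: the
   correction is minus the derivative along [nabla_(e_i) e_j] *)
pose H i j := N i j + \sum_k (tangent_form x (e i x) k j)%:C%C *: chi k x.
have DD : Dirac lc th A (Dirac lc th A (expr phi)) s x
    = \sum_i \sum_j cl i (cl j (H i j)).
  rewrite DiracE; apply: eq_bigr => i _; rewrite DiracE.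
  rewrite (nab_sum oU _ _ _ (F := fun j y => cl j (chi j y))) //; last first.
    by move=> j; apply: smooth_mx_mul => //; exact: smooth_mx_cst.
  rewrite -cl_sum; congr (cl i _).
  rewrite [RHS](eq_bigr (fun j => cl j (N i j)
    + \sum_k (tangent_form x (e i x) k j)%:C%C *: cl j (chi k x))); last first.
    by move=> j _; rewrite clD cl_sum; congr (_ + _); apply: eq_bigr => k _; rewrite clZ.
  rewrite [LHS](eq_bigr (fun j => cl j (N i j)
    + \sum_k (tangent_form x (e i x) j k)%:C%C *: cl k (chi j x))); last first.
    by move=> j _; exact: nab_cl.
  apply: etrans (big_split _ _ _ _ _) _; apply: etrans _ (esym (big_split _ _ _ _ _)).
  apply: (f_equal2 +%R (erefl _)); exact: exchange_big.
have lapE : laplacian lc th A (expr phi) s x = - \sum_i H i i.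
  rewrite big_split /= opprD; congr (- _ - _).
    by apply: eq_bigr => i _; rewrite /nablaE nablaS_nab; apply: (nab_ext oU) => // y Uy; rewrite nablaS_nab.
  rewrite exchange_big; apply: eq_bigr => i _ /=.
  rewrite /nablaE nablaS_nab -scaler_suml; congr (_ *: _).
  by rewrite rmorph_sum; apply: eq_bigr => j _; rewrite mxE.
have anti i j : H i j - H j i
    = F x *m (curv spin_form (e i) (e j) x)^T + curv twist_form (e i) (e j) x *m F x.
  have NC : N i j - N j i - D F x (lie (e i) (e j) x)
      = F x *m (curv spin_form (e i) (e j) x)^T + curv twist_form (e i) (e j) x *m F x.
    exact: (nab_commutator oU smooth_spin_form smooth_twist_form Ux (sE i) (sE j) sF).
  rewrite -NC (nab_linear_frame _ Ux sF) /H opprD addrACA -sumrB; congr (_ + _).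
  rewrite -sumrN; apply: eq_bigr => k _; rewrite -scalerBl -scaleNr; congr (_ *: _).
  rewrite (frame_torsion lc oU sE _ _ _ Ux) -rmorphB -rmorphN; congr (_%:C%C).
  have sk v a b : tangent_form x v b a = - tangent_form x v a b.
    by have := congr1 (fun L : 'M[R]_n => L a b) (tangent_form_skew v Ux); rewrite !mxE.
  by rewrite (sk _ j k) (sk _ i k) /tangent_form; ring.
rewrite DD cl_double_sum -lapE; move: (laplacian _ _ _ _ _ _) => L.
rewrite -!addrA; congr (_ + _).
rewrite -(Ricci_contraction _ Ux) -(twist_contraction _ Ux) -big_split.
apply: eq_bigr => i _ /=; rewrite -big_split; apply: eq_bigr => j _ /=.
by rewrite anti !clD.
Qed.

End Lichnerowicz.

Theorem theorem3p1 (R : realType) (n r : nat)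
  (hr : (0 < r)%N) (M : oriented_manifold R n) (g : riemannian_metric M)
  (lc : levi_civita g) (S : spincr_structure r g)
  (th : SO_connection (PSO S)) (A : U1_connection (PU S))
  (phi : Pspin S -> twisted R n r) (hphi : twisted_spinor phi)
  (U : set M) (s : M -> Pspin S) (hs : smooth_section U s)
  (x : M) (hx : U x) :
  Dirac lc th A (Dirac lc th A (expr phi)) s x
    = laplacian lc th A (expr phi) s x
      + (scal lc s x / 4)%:C%C *: expr phi s x
      + 2^-1 *: cl_Theta th (expr phi) s x
      + ('i%C / 2) *: cl_dA A (expr phi) s x.
Proof. exact: (lichnerowicz lc th A hphi hs hx). Qed.
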